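(* Let $(X,d)$ and $(Y,\partial)$ be uniformly locally finite metric spaces such that all the ghost projections in $\mathrm{C}^*_u(X)$ and in $\mathrm{C}^*_u(Y)$ are compact. If $\mathrm{C}^*_u(X)$ and $\mathrm{C}^*_u(Y)$ are isomorphic, then $(X,d)$ and $(Y,\partial)$ are coarsely equivalent.
   Context: Coarse structures. A coarse structure on a set $X$ is a collection $\mathcal{E}$ of subsets of $X\times X$ (called entourages) which contains the diagonal $\Delta_X=\{(x,x): x\in X\}$ and is closed under taking subsets, inverses $E^{-1}=\{(x,y):(y,x)\in E\}$, finite unions, and compositions $E\circ F=\{(x,y): \exists z\ (x,z)\in E,\ (z,y)\in F\}$; $(X,\mathcal{E})$ is a coarse space. A metric space $(X,d)$ is given its bounded coarse structure $\mathcal{E}_d$, the smallest coarse structure containing all $E_r=\{(x,y): d(x,y)\le r\}$, $r\ge 0$. A coarse space $(X,\mathcal{E})$ is uniformly locally finite if $\sup_{x\in X}|\{y\in X:(x,y)\in E\}|<\infty$ for all $E\in\mathcal{E}$; a metric space is uniformly locally finite if its bounded coarse structure is. Coarse maps. Let $(X,\mathcal{E})$, $(Y,\mathcal{F})$ be coarse spaces. Maps $f,g:Z\to X$ from a set $Z$ are close if $\{(f(z),g(z)): z\in Z\}\in\mathcal{E}$. A map $f:X\to Y$ is coarse if for all $E\in\mathcal{E}$ there is $F\in\mathcal{F}$ such that $(x,x')\in E$ implies $(f(x),f(x'))\in F$. A coarse map $f:X\to Y$ is a coarse equivalence if there is a coarse map $g:Y\to X$ such that $g\circ f$ and $f\circ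 g$ are close to $\mathrm{Id}_X$ and $\mathrm{Id}_Y$; in that case the spaces are coarsely equivalent. Uniform Roe algebras. For $T\in B(\ell_2(X))$ let $\mathrm{supp}(T)=\{(x,x'):\langle T\delta_x,\delta_{x'}\rangle\ne 0\}$. The uniform Roe algebra $\mathrm{C}^*_u(X)$ is the norm closure in $B(\ell_2(X))$ of $\{T\in B(\ell_2(X)): \mathrm{supp}(T)\in\mathcal{E}\}$. Isomorphisms of C*-algebras are $*$-isomorphisms. An operator $T\in \mathrm{C}^*_u(X)$ is a ghost if for all $\varepsilon>0$ there is a finite $A\subset X$ such that $|\langle T\delta_x,\delta_{x'}\rangle|<\varepsilon$ for all $x,x'\in X\setminus A$. *)

(* Defs.v *)
From HB Require Import structures.
From mathcomp Require Import all_boot all_order all_algebra.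
From mathcomp Require Import all_classical all_reals all_analysis.
From mathcomp Require Import complex.
From mathcomp Require Import ring lra.

Set Implicit Arguments.
Unset Strict Implicit.
Unset Printing Implicit Defensive.

Import Order.TTheory GRing.Theory Num.Theory.
Import numFieldNormedType.Exports.

Local Open Scope classical_set_scope.
Local Open Scope ring_scope.
Local Open Scope complex_scope.
Local Open Scope card_scope.

Section square_summable.
Variables (R : realType) (X : choiceType).
Implicit Types (z w : R[i]) (u v : X -> R[i]).

Definition normsq z : R := complex.Re z ^+ 2 + complex.Im z ^+ 2.

Lemma normsqE z : (normsq z)%:C = `|z| ^+ 2.
Proof. exact: add_Re2_Im2. Qed.

Lemma normsq_ge0 z : 0 <= normsq z.
Proof. by rewrite /normsq addr_ge0 ?sqr_ge0. Qed.

Lemma normsqM z w : normsq (z * w) = normsq z * normsq w.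
Proof. by case: z w => [a b] [c d]; rewrite /normsq /=; ring. Qed.

Lemma normsq_eq0 z : normsq z = 0 -> z = 0.
Proof.
move=> z0; have := normsqE z; rewrite z0 => /esym/eqP.
by rewrite expf_eq0 normr_eq0 => /eqP.
Qed.

Lemma normsqD (t : R) z w : 0 < t ->
  normsq (z + w) <= (1 + t) * normsq z + (1 + t^-1) * normsq w.
Proof.
case: z w => [a b] [c d] t0; rewrite /normsq /=.
have aux (x y : R) : (x + y) ^+ 2 <= (1 + t) * x ^+ 2 + (1 + t^-1) * y ^+ 2.
  rewrite -subr_ge0 (_ : _ - _ = t * (x - t^-1 * y) ^+ 2).
    by rewrite mulr_ge0 ?sqr_ge0 // ltW.
  by field; rewrite gt_eqF.
by have := aux a c; have := aux b d; lra.
Qed.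

Definition l2sq u : \bar R := \esum_(x in [set: X]) (normsq (u x))%:E.

Definition square_summable : {pred X -> R[i]} := [pred u | (l2sq u < +oo)%E].

Lemma l2sq_ge0 u : (0 <= l2sq u)%E.
Proof. by apply: esum_ge0 => x _; rewrite lee_fin normsq_ge0. Qed.

Lemma esum_le_scale (c : R) (f : X -> \bar R) : 0 <= c ->
    (forall x, (0 <= f x)%E) ->
  (\esum_(x in [set: X]) (c%:E * f x) <= c%:E * \esum_(x in [set: X]) f x)%E.
Proof.
move=> c0 f0; apply: ge_ereal_sup => _ /= [A [finA AX] <-].
rewrite -ge0_mule_fsumr //; apply: lee_pmul => //.
- by apply: fsume_ge0 => x _.
- by apply: ereal_sup_ubound; exists A.
Qed.

Lemma l2sqZ_le z u : (l2sq (z *: u) <= (normsq z)%:E * l2sq u)%E.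
Proof.
apply: le_trans; last first.
  apply: esum_le_scale; first exact: normsq_ge0.
  by move=> x; rewrite lee_fin normsq_ge0.
by apply: le_esum => x _; rewrite -EFinM lee_fin -normsqM.
Qed.

Lemma l2sqD_le (t : R) u v : 0 < t ->
  (l2sq (u + v)%R <= (1 + t)%:E * l2sq u + (1 + t^-1)%:E * l2sq v)%E.
Proof.
move=> t0.
have tp : 0 <= 1 + t by rewrite addr_ge0 // ltW.
have tn : 0 <= 1 + t^-1 by rewrite addr_ge0 // ltW // invr_gt0.
have pos (w : R[i]) : (0 <= (normsq w)%:E)%E by rewrite lee_fin normsq_ge0.
apply: (@le_trans _ _ (\esum_(x in [set: X])
  ((1 + t)%:E * (normsq (u x))%:E + (1 + t^-1)%:E * (normsq (v x))%:E))%E).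
  apply: le_esum => x _; rewrite -!EFinM -EFinD lee_fin; exact: normsqD.
rewrite esumD; [|by move=> x _; rewrite mule_ge0..].
by apply: leeD; apply: esum_le_scale.
Qed.

Fact square_summable_submod_closed : submod_closed square_summable.
Proof.
have ltZ z u : u \in square_summable -> z *: u \in square_summable.
  rewrite !inE => u2; apply: (le_lt_trans (l2sqZ_le _ _)).
  by rewrite lte_mul_pinfty // lee_fin normsq_ge0.
split.
  rewrite inE /l2sq esum1 // => x _.
  by rewrite /normsq /= expr0n /= addr0.
move=> z u v /(ltZ z) zu2 v2; move: zu2 v2; rewrite !inE => zu2 v2.
apply: (le_lt_trans (@l2sqD_le 1 _ _ ltr01)).
by rewrite lte_add_pinfty // lte_mul_pinfty // lee_fin ?invr1 addr_ge0.
Qed.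

HB.instance Definition _ := GRing.isSubmodClosed.Build _ _ square_summable
  square_summable_submod_closed.

Record l2 := L2 { l2_fun :> X -> R[i]; l2_funP : l2_fun \in square_summable }.

HB.instance Definition _ := [isSub for l2_fun].
HB.instance Definition _ := [Choice of l2 by <:].
HB.instance Definition _ := [SubChoice_isSubLmodule of l2 by <:].

End square_summable.

Arguments l2 : clear implicits.

Section l2_norm.
Variables (R : realType) (X : choiceType).
Implicit Types (u v : l2 R X).

Definition l2norm u : R := Num.sqrt (fine (l2sq u)).

Lemma l2norm_ge0 u : 0 <= l2norm u. Proof. exact: sqrtr_ge0. Qed.

Lemma l2sq_fin u : l2sq u = (l2norm u ^+ 2)%:E.
Proof.
rewrite sqr_sqrtr ?fine_ge0 ?l2sq_ge0 // fineK // ge0_fin_numE ?l2sq_ge0 //.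
exact: l2_funP.
Qed.

Lemma l2norm_eq0 u : l2norm u = 0 -> u = 0.
Proof.
move=> u0; apply/val_inj/funext => x /=; apply: normsq_eq0.
apply/eqP; rewrite eq_le normsq_ge0 andbT -lee_fin.
have -> : 0%:E = l2sq u by rewrite l2sq_fin u0 expr0n.
rewrite -(@esum_set1 _ _ x (fun x => (normsq (u x))%:E)) ?lee_fin ?normsq_ge0//.
rewrite /l2sq esum_mkcond; apply: le_esum => y _.
by case: ifP; rewrite lee_fin ?normsq_ge0.
Qed.

Lemma l2norm0 : l2norm (0 : l2 R X) = 0.
Proof.
rewrite /l2norm /l2sq esum1 ?sqrtr0 // => x _ /=.
by rewrite /normsq /= expr0n /= addr0.
Qed.

Lemma l2normZ_le (z : R[i]) u : l2norm (z *: u) <= Num.sqrt (normsq z) * l2norm u.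
Proof.
rewrite -(@ler_pXn2r _ 2) ?nnegrE ?mulr_ge0 ?sqrtr_ge0 //.
rewrite exprMn (sqr_sqrtr (normsq_ge0 z)) -lee_fin [leRHS]EFinM -!l2sq_fin.
exact: l2sqZ_le.
Qed.

Lemma l2normZ (z : R[i]) u : l2norm (z *: u) = Num.sqrt (normsq z) * l2norm u.
Proof.
have [->|z0] := eqVneq z 0.
  by rewrite scale0r l2norm0 /normsq /= expr0n /= addr0 sqrtr0 mul0r.
apply/eqP; rewrite eq_le l2normZ_le /=.
have zV : Num.sqrt (normsq z) * Num.sqrt (normsq z^-1) = 1.
  rewrite -sqrtrM ?normsq_ge0 // -normsqM divff //.
  by rewrite /normsq /= expr1n expr0n /= addr0 sqrtr1.
have := l2normZ_le z^-1 (z *: u); rewrite scalerA mulVf // scale1r.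
move=> /(ler_wpM2l (sqrtr_ge0 (normsq z))).
by rewrite mulrA zV mul1r.
Qed.

Lemma l2normD u v : l2norm (u + v) <= l2norm u + l2norm v.
Proof.
have [u0|u0] := eqVneq (l2norm u) 0.
  by rewrite (l2norm_eq0 u0) add0r l2norm0 add0r.
have [v0|v0] := eqVneq (l2norm v) 0.
  by rewrite (l2norm_eq0 v0) addr0 l2norm0 addr0.
have {}u0 : 0 < l2norm u by rewrite lt_def u0 l2norm_ge0.
have {}v0 : 0 < l2norm v by rewrite lt_def v0 l2norm_ge0.
rewrite -(@ler_pXn2r _ 2) ?nnegrE ?addr_ge0 ?l2norm_ge0 //.
have := @l2sqD_le R X (l2norm v / l2norm u) u v (divr_gt0 v0 u0).
rewrite -[(u : X -> R[i]) + v]/((u + v : l2 R X) : X -> R[i]) !l2sq_fin.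
rewrite -!EFinM -EFinD lee_fin => /le_trans; apply.
by rewrite le_eqVlt; apply/orP; left; apply/eqP; field; rewrite !gt_eqF.
Qed.

Definition l2normC u : R[i] := (l2norm u)%:C.

Fact l2normC_D u v : l2normC (u + v) <= l2normC u + l2normC v.
Proof. by rewrite /l2normC -rmorphD /= lecR l2normD. Qed.

Fact l2normC_Z (z : R[i]) u : l2normC (z *: u) = `|z| * l2normC u.
Proof.
by rewrite /l2normC l2normZ rmorphM /= normc_def.
Qed.

Fact l2normC_eq0 u : l2normC u = 0 -> u = 0.
Proof. by move=> /complexI; exact: l2norm_eq0. Qed.

HB.instance Definition _ := @Lmodule_isNormed.Build R[i] (l2 R X)
  l2normC l2normC_D l2normC_Z l2normC_eq0.

Lemma l2_normE u : `|u| = (l2norm u)%:C. Proof. by []. Qed.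

End l2_norm.

Section inner_product.
Variables (R : realType) (X : choiceType).
Implicit Types (u v : l2 R X) (T S : l2 R X -> l2 R X).

(* Unordered sums over X of absolutely summable real, resp. complex, families;
   they are only meaningful for such families. *)
Definition rsum (f : X -> R) : R :=
  fine (\esum_(x in [set: X]) (f^\+ x)%:E) -
  fine (\esum_(x in [set: X]) (f^\- x)%:E).

Definition csum (f : X -> R[i]) : R[i] :=
  rsum (fun x => complex.Re (f x)) +i* rsum (fun x => complex.Im (f x)).

Definition inner u v : R[i] := csum (fun x => u x * (v x)^*).

Fact delta_square_summable (x : X) :
  (fun y => (y == x)%:R : R[i]) \in @square_summable R X.
Proof.
rewrite inE /l2sq (eq_esum (b := fun y =>
  if y \in [set x] then (normsq (1 : R[i]))%:E else 0%E)).
  by rewrite -esum_mkcond esum_set1 ?ltry // lee_fin normsq_ge0.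
move=> y _; rewrite in_set1; case: eqP => //= _.
by rewrite /normsq /= expr0n /= addr0.
Qed.

Definition delta (x : X) : l2 R X := L2 (delta_square_summable x).

Lemma rsum_set1 (f : X -> R) x : (forall y, y != x -> f y = 0) -> rsum f = f x.
Proof.
move=> fx.
have one (g : X -> R) : 0 <= g x -> (forall y, y != x -> g y = 0) ->
    fine (\esum_(y in [set: X]) (g y)%:E) = g x.
  move=> g0 gx; rewrite (eq_esum (b := fun y =>
    if y \in [set x] then (g y)%:E else 0%E)).
    by rewrite -esum_mkcond esum_set1.
  by move=> y _; rewrite in_set1; case: eqVneq => //= /gx ->.
rewrite /rsum !one ?funrpos_ge0 ?funrneg_ge0 //.
- by rewrite -[in RHS](funrposBneg f).
- by move=> y /fx fy; rewrite /funrneg fy oppr0 maxxx.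
- by move=> y /fx fy; rewrite /funrpos fy maxxx.
Qed.

Lemma inner_norm u : inner u u = (l2norm u)%:C ^+ 2.
Proof.
rewrite -rmorphXn /= sqr_sqrtr ?fine_ge0 ?l2sq_ge0 //.
have E x : u x * (u x)^* = (normsq (u x))%:C.
  by case: (u x) => a b; rewrite /normsq /=; simpc; congr (_ +i* _); ring.
rewrite /inner /csum; congr (_ +i* _); rewrite /rsum.
  rewrite [X in _ - X](_ : _ = 0) ?subr0.
    congr fine; apply: eq_esum => x _; congr EFin.
    by rewrite /funrpos E /= max_l ?normsq_ge0.
  rewrite esum1 // => x _; congr EFin.
  by rewrite /funrneg E /= max_r // oppr_le0 normsq_ge0.
rewrite !esum1 ?subr0 // => x _; congr EFin;
  by rewrite /funrneg /funrpos E /= ?oppr0 maxxx.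
Qed.

Lemma inner_delta u x : inner u (delta x) = u x.
Proof.
rewrite /inner /csum (rsum_set1 (x := x)) ?(rsum_set1 (x := x)).
- by rewrite /= eqxx; case: (u x) => a b /=; simpc.
- by move=> y /negPf /= ->; case: (u y) => a b /=; simpc.
- by move=> y /negPf /= ->; case: (u y) => a b /=; simpc.
Qed.

Definition bounded_operator : set (l2 R X -> l2 R X) :=
  [set T | linear T /\ exists M : R, forall u, l2norm (T u) <= M * l2norm u].

Definition opnorm T : R := sup [set l2norm (T u) | u in [set u | l2norm u <= 1]].

(* S is the adjoint of T; the relation determines S. *)
Definition is_adjoint T S := forall u v, inner (T u) v = inner u (S v).

Definition projection T := T \o T = T /\ is_adjoint T T.

Definition compact_operator T :=
  compact (closure (T @` [set u | l2norm u <= 1])).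

Definition supp T : set (X * X) :=
  [set xx | inner (T (delta xx.1)) (delta xx.2) != 0].

Definition ghost T := forall eps : R, 0 < eps ->
  exists2 A : set X, finite_set A &
    forall x x', ~ A x -> ~ A x' -> `|inner (T (delta x)) (delta x')| < eps%:C.

Definition uniform_roe (E : set (set (X * X))) : set (l2 R X -> l2 R X) :=
  [set T | bounded_operator T /\ forall eps : R, 0 < eps ->
    exists S, [/\ bounded_operator S, E (supp S) & opnorm (T \- S) < eps]].

End inner_product.

Arguments uniform_roe R {X} E.

(* Phi is only relevant on A; the last clause says Phi (T^* ) = (Phi T)^* when A
   is closed under adjoints. *)
Definition star_isomorphic (R : realType) (X Y : choiceType)
    (A : set (l2 R X -> l2 R X)) (B : set (l2 R Y -> l2 R Y)) :=
  exists Phi : (l2 R X -> l2 R X) -> (l2 R Y -> l2 R Y),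
    [/\ set_bij A B Phi,
        forall S T, A S -> A T -> Phi (S \+ T) = Phi S \+ Phi T,
        forall (c : R[i]) T, A T -> Phi (c \*: T) = c \*: Phi T,
        forall S T, A S -> A T -> Phi (S \o T) = Phi S \o Phi T &
        forall S T, A S -> A T -> is_adjoint T S -> is_adjoint (Phi T) (Phi S)].

Record coarse_structure (X : Type) (E : set (set (X * X))) : Prop :=
  CoarseStructure {
    coarse_diagonal : E diagonal ;
    coarse_subset : forall A B, A `<=` B -> E B -> E A ;
    coarse_inverse : forall A, E A -> E (A^-1)%relation ;
    coarse_setU : forall A B, E A -> E B -> E (A `|` B) ;
    coarse_compose : forall A B, E A -> E B -> E (B \; A)%relation }.

Definition bounded_coarse (R : realType) (X : metricType R) :
    set (set (X * X)) :=
  smallest (@coarse_structure X)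
    [set A | exists2 r : R, 0 <= r & A = [set xy | mdist xy.1 xy.2 <= r]].

Arguments bounded_coarse {R} X.

Lemma bounded_coarse_structure (R : realType) (X : metricType R) :
  coarse_structure (bounded_coarse X).
Proof.
split => [F [Fc _]|A B AB EB F FG|A EA F FG|A B EA EB F FG|A B EA EB F FG].
- exact: coarse_diagonal.
- by case: (FG) => Fc _; exact: (coarse_subset Fc AB (EB _ FG)).
- by case: (FG) => Fc _; exact: (coarse_inverse Fc (EA _ FG)).
- by case: (FG) => Fc _; exact: (coarse_setU Fc (EA _ FG) (EB _ FG)).
- by case: (FG) => Fc _; exact: (coarse_compose Fc (EA _ FG) (EB _ FG)).
Qed.

Definition uniformly_locally_finite (X : Type) (E : set (set (X * X))) :=
  forall A, E A -> exists n : nat, forall x, [set y | A (x, y)] #<= `I_n.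

Definition coarse_close (Z X : Type) (E : set (set (X * X))) (f g : Z -> X) :=
  E (range (fun z => (f z, g z))).

Definition coarse_map (X Y : Type) (E : set (set (X * X)))
    (F : set (set (Y * Y))) (f : X -> Y) :=
  forall A, E A -> exists2 B, F B & forall x x', A (x, x') -> B (f x, f x').

Definition coarse_equivalence (X Y : Type) (E : set (set (X * X)))
    (F : set (set (Y * Y))) (f : X -> Y) :=
  coarse_map E F f /\
  exists g : Y -> X, [/\ coarse_map F E g, coarse_close E (g \o f) id &
                         coarse_close F (f \o g) id].

Definition coarsely_equivalent (X Y : Type) (E : set (set (X * X)))
    (F : set (set (Y * Y))) :=
  exists f : X -> Y, coarse_equivalence E F f.

(* Main.v *)
(** Let Phi be the isomorphism. It maps the matrix units e_xx' to rank one
    operators u |-> <u, xi_x'> xi_x with unit vectors xi_x in l2 Y, because e_xx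
    is a minimal projection and the target contains the matrix units of l2 Y.
    Phi^-1 maps e_yy' to u |-> <u, eta_y'> eta_y, where eta_y(x) is the
    conjugate of xi_x(y), and <Phi(T) delta_y', delta_y> = <T eta_y', eta_y>.

    The coefficients satisfy inf_x sup_y |xi_x(y)| > 0. Otherwise there is an
    infinite A such that the sum of sup_y |xi_x(y)|^2 over x in A is finite.
    Then Phi(chi_A) is a ghost projection that fixes the infinite orthonormal
    family (xi_x) with x in A, so it is not compact. Choose f : X -> Y with
    |xi_x(f(x))| bounded below, and g : Y -> X likewise for eta.

    If d(x, x') <= r and |xi_x(y)|, |xi_x'(y')| are bounded below, then d(y, y')
    is bounded. Otherwise a sparse sequence of bad quadruples
    (x_n, x'_n, y_n, y'_n) gives a partial translation T, mapping delta_(x'_n)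
    to delta_(x_n), such that <Phi(T) delta_(y'_n), delta_(y_n)> is bounded
    below although d(y_n, y'_n) tends to infinity. This estimate and its mirror
    image show that f and g are coarse and mutually inverse up to closeness. *)
From HB Require Import structures.
Require Import Defs.
From mathcomp Require Import all_boot all_order all_algebra.
From mathcomp Require Import all_classical all_reals all_analysis.
From mathcomp Require Import complex.
From mathcomp Require Import ring lra.

Set Implicit Arguments.
Unset Strict Implicit.
Unset Printing Implicit Defensive.

Import Order.TTheory GRing.Theory Num.Theory.
Import numFieldNormedType.Exports.

Local Open Scope classical_set_scope.
Local Open Scope complex_scope.
Local Open Scope ring_scope.

(** * Unordered sums *)

Section unordered_sums.
Variables (R : realType) (X : choiceType).
Implicit Types f g h : X -> R.

Definition abs_summable f := (\esum_(x in [set: X]) `|f x|%:E < +oo)%E.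

Lemma abs_summableP f : abs_summable f <-> summable [set: X] (EFin \o f).
Proof. by []. Qed.

Lemma abs_summable_le f g : (forall x, `|f x| <= g x) -> abs_summable g ->
  abs_summable f.
Proof.
move=> fg; apply: le_lt_trans; apply: le_esum => x _.
by rewrite lee_fin (le_trans (fg x)) ?ler_norm.
Qed.

Lemma abs_summableD f g : abs_summable f -> abs_summable g ->
  abs_summable (fun x => f x + g x).
Proof. by move=> /abs_summableP sf /abs_summableP sg; have := summableD sf sg. Qed.

Lemma abs_summable_pos f : abs_summable f -> abs_summable f^\+.
Proof.
move=> sf; apply: (@abs_summable_le _ (fun x => `|f x|)) => [x|].
  by rewrite ger0_norm ?funrpos_ge0// /funrpos ge_max ler_norm normr_ge0.
by rewrite /abs_summable; under eq_esum do rewrite normr_id.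
Qed.

Lemma abs_summable_neg f : abs_summable f -> abs_summable f^\-.
Proof.
move=> sf; apply: (@abs_summable_le _ (fun x => `|f x|)) => [x|].
  by rewrite ger0_norm ?funrneg_ge0// /funrneg ge_max -normrN ler_norm normr_ge0.
by rewrite /abs_summable; under eq_esum do rewrite normr_id.
Qed.

Lemma fine_esumD f g : (forall x, 0 <= f x) -> (forall x, 0 <= g x) ->
    abs_summable f -> abs_summable g ->
  fine (\esum_(x in [set: X]) (f x + g x)%:E) =
  fine (\esum_(x in [set: X]) (f x)%:E) + fine (\esum_(x in [set: X]) (g x)%:E).
Proof.
move=> f0 g0 sf sg.
have fin h : (forall x, 0 <= h x) -> abs_summable h ->
    (\esum_(x in [set: X]) (h x)%:E)%E \is a fin_num.
  move=> h0; rewrite /abs_summable ge0_fin_numE ?esum_ge0//.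
    by under eq_esum do rewrite ger0_norm//.
  by move=> x _; rewrite lee_fin.
rewrite (eq_esum (b := fun x => ((f x)%:E + (g x)%:E)%E)); last by [].
by rewrite esumD ?fineD ?fin// => x _; rewrite lee_fin.
Qed.

(** The value of [rsum] does not depend on how a function is written as a difference of nonnegative
    summable functions. Comparison with the canonical parts of [h] rests on the identity
    [f + h^\- = g + h^\+], which only involves nonnegative terms. *)
Lemma rsumB f g : (forall x, 0 <= f x) -> (forall x, 0 <= g x) ->
    abs_summable f -> abs_summable g ->
  rsum (fun x => f x - g x) =
  fine (\esum_(x in [set: X]) (f x)%:E) - fine (\esum_(x in [set: X]) (g x)%:E).
Proof.
move=> f0 g0 sf sg; set h := fun x => f x - g x.
have pos x : 0 <= h^\+ x by exact: funrpos_ge0.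
have neg x : 0 <= h^\- x by exact: funrneg_ge0.
have pn x : f x + h^\- x = g x + h^\+ x.
  have : h^\+ x - h^\- x = f x - g x.
    exact: (congr1 (fun u => u x) (funrposBneg h)).
  lra.
have sh : abs_summable h by apply: abs_summableD sf _; rewrite /abs_summable;
  under eq_esum do rewrite normrN.
have sp := abs_summable_pos sh; have sn := abs_summable_neg sh.
have := fine_esumD f0 neg sf sn; have := fine_esumD g0 pos sg sp.
under eq_esum do rewrite -pn.
move=> -> e; apply/eqP.
by rewrite /rsum subr_eq addrAC -e addrC addKr.
Qed.

Lemma rsumD f g : abs_summable f -> abs_summable g ->
  rsum (fun x => f x + g x) = rsum f + rsum g.
Proof.
move=> sf sg.
have pos h x : 0 <= h^\+ x by exact: funrpos_ge0.
have neg h x : 0 <= h^\- x by exact: funrneg_ge0.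
have sp := abs_summable_pos; have sn := abs_summable_neg.
have E : (fun x => f x + g x) =
    (fun x => (f^\+ x + g^\+ x) - (f^\- x + g^\- x)).
  apply/funext => x; rewrite -[in LHS](funrposBneg f) -[in LHS](funrposBneg g) /=.
  by rewrite addrACA opprD.
rewrite E rsumB.
- rewrite (fine_esumD (pos f) (pos g) (sp f sf) (sp g sg)).
  rewrite (fine_esumD (neg f) (neg g) (sn f sf) (sn g sg)).
  by rewrite opprD addrACA.
- by move=> x; rewrite addr_ge0.
- by move=> x; rewrite addr_ge0.
- by apply: abs_summableD; exact: sp.
- by apply: abs_summableD; exact: sn.
Qed.

Lemma rsumN f : rsum (fun x => - f x) = - rsum f.
Proof.
rewrite /rsum opprB; congr (fine _ - fine _); apply: eq_esum => x _; congr EFin.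
by rewrite /funrpos /funrneg opprK.
Qed.

Lemma esum_EFinM_le (c : R) f : 0 <= c -> (forall x, 0 <= f x) ->
  (\esum_(x in [set: X]) (c * f x)%:E <= c%:E * \esum_(x in [set: X]) (f x)%:E)%E.
Proof.
move=> c0 f0; rewrite (eq_esum (b := fun x => (c%:E * (f x)%:E)%E)) => [|x _].
  by apply: esum_le_scale => // x; rewrite lee_fin.
by rewrite EFinM.
Qed.

Lemma fine_esumZ (c : R) f : 0 <= c -> (forall x, 0 <= f x) ->
  fine (\esum_(x in [set: X]) (c * f x)%:E) =
  c * fine (\esum_(x in [set: X]) (f x)%:E).
Proof.
move=> c0 f0; have [->|cN0] := eqVneq c 0.
  by rewrite mul0r esum1// => x _; rewrite mul0r.
have {cN0}cp : 0 < c by rewrite lt_def cN0.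
have -> : (\esum_(x in [set: X]) (c * f x)%:E)%E =
    (c%:E * \esum_(x in [set: X]) (f x)%:E)%E.
  apply/eqP; rewrite eq_le esum_EFinM_le//=.
  rewrite -lee_pdivlMl//.
  have := @esum_EFinM_le c^-1 (fun x => c * f x); rewrite invr_ge0 => /(_ c0) /=.
  rewrite (_ : (fun _ => _) = fun x => (f x)%:E); last first.
    by apply/funext => x; rewrite mulKf// gt_eqF.
  by apply=> x; rewrite mulr_ge0.
(* An infinite sum stays infinite after scaling by [c > 0], and [fine] sends it to 0 on both
   sides. *)
case: (\esum_(x in [set: X]) (f x)%:E)%E => [r||] //=.
  by rewrite gt0_muley ?lte_fin //= mulr0.
by rewrite gt0_muleNy ?lte_fin //= mulr0.
Qed.

Lemma rsumZ (c : R) f : rsum (fun x => c * f x) = c * rsum f.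
Proof.
wlog c0 : c f / 0 <= c.
  move=> H; have [c0|/ltW c0] := leP 0 c; first exact: H.
  rewrite -[RHS]mulrNN -rsumN -H ?oppr_ge0//.
  by congr rsum; apply/funext => x; rewrite mulrNN.
rewrite /rsum mulrBr -(fine_esumZ c0 (fun=> funrpos_ge0 _ _)).
rewrite -(fine_esumZ c0 (fun=> funrneg_ge0 _ _)).
congr (fine _ - fine _); apply: eq_esum => x _; congr EFin.
  by rewrite /funrpos maxr_pMr// mulr0.
by rewrite /funrneg maxr_pMr// mulr0 mulrN.
Qed.

Lemma abs_summableZ (c : R) f : abs_summable f -> abs_summable (fun x => c * f x).
Proof.
move=> sf; rewrite /abs_summable; under eq_esum do rewrite normrM.
apply: (@le_lt_trans _ _ (`|c|%:E * \esum_(x in [set: X]) `|f x|%:E)%E).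
  exact: esum_EFinM_le.
by rewrite lte_mul_pinfty.
Qed.

End unordered_sums.

(** * Inner product and density *)

Section inner_product_theory.
Variables (R : realType) (X : choiceType).
Implicit Types (x y : X) (u v w : l2 R X) (z c : R[i]) (f g : X -> R[i]).

Lemma normsq0 : normsq (0 : R[i]) = 0.
Proof. by rewrite /normsq /= expr0n /= addr0. Qed.

Lemma normsq1 : normsq (1 : R[i]) = 1.
Proof. by rewrite /normsq /= expr0n /= addr0 expr1n. Qed.

Lemma normsq_conj z : normsq z^* = normsq z.
Proof. by case: z => a b; rewrite /normsq /= sqrrN. Qed.

Lemma normsqN z : normsq (- z) = normsq z.
Proof. by case: z => a b; rewrite /normsq /= !sqrrN. Qed.

Lemma mulr_conj z : z * z^* = (normsq z)%:C.
Proof. by case: z => a b; rewrite /normsq /=; simpc; congr (_ +i* _); ring. Qed.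

Lemma conjC_real (r : R) : (r%:C)^* = r%:C.
Proof. exact: conjc_real. Qed.

Lemma real_complexM (a b : R) : (a * b)%:C = a%:C * b%:C.
Proof. exact: rmorphM. Qed.

Lemma real_complexB (a b : R) : (a - b)%:C = a%:C - b%:C.
Proof. exact: rmorphB. Qed.

Lemma conjCD z c : (z + c)^* = z^* + c^*.
Proof. exact: rmorphD. Qed.

Lemma conjCM z c : (z * c)^* = z^* * c^*.
Proof. exact: rmorphM. Qed.

Lemma conjCN z : (- z)^* = - z^*.
Proof. exact: rmorphN. Qed.

Definition csummable f :=
  abs_summable (fun x => complex.Re (f x)) /\ abs_summable (fun x => complex.Im (f x)).

Lemma csumD f g : csummable f -> csummable g ->
  csum (fun x => f x + g x) = csum f + csum g.
Proof.
move=> [fr fi] [gr gi]; rewrite /csum; apply/eqP; rewrite eq_complex /=.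
rewrite -!rsumD//; apply/andP; split; apply/eqP; congr rsum; apply/funext => x;
  by case: (f x) (g x) => a b [].
Qed.

Lemma csumZ c f : csummable f -> csum (fun x => c * f x) = c * csum f.
Proof.
case: c => a b [fr fi]; rewrite /csum; apply/eqP; rewrite eq_complex /=.
rewrite -mulNr -!rsumZ -!rsumD; try exact: abs_summableZ.
apply/andP; split; apply/eqP; congr rsum; apply/funext => x;
  by case: (f x) => p q /=; ring.
Qed.

Lemma csum_conj f : csum (fun x => (f x)^*) = (csum f)^*.
Proof.
rewrite /csum -[RHS]/(Complex _ (- rsum _)) -rsumN.
by congr Complex; congr rsum; apply/funext => x; case: (f x).
Qed.

Lemma l2_abs_summable u : abs_summable (fun x => normsq (u x)).
Proof.
rewrite /abs_summable; under eq_esum do rewrite ger0_norm ?normsq_ge0//.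
exact: l2_funP.
Qed.

Lemma inner_csummable u v : csummable (fun x => u x * (v x)^*).
Proof.
(* This function dominates the real and imaginary parts of [u x * (v x)^*], because squares of sums
   and differences of coordinates are nonnegative. *)
have s : abs_summable (fun x => normsq (u x) + normsq (v x)).
  by apply: abs_summableD; exact: l2_abs_summable.
split; apply: abs_summable_le s => x; rewrite /normsq ler_norml;
  case: (u x) (v x) => a b [c d] /=; simpc.
  have := sqr_ge0 (a - c); have := sqr_ge0 (a + c); have := sqr_ge0 (b - d).
  by have := sqr_ge0 (b + d); rewrite !expr2 => ????; apply/andP; split; lra.
have := sqr_ge0 (a - d); have := sqr_ge0 (a + d); have := sqr_ge0 (b - c).
by have := sqr_ge0 (b + c); rewrite !expr2 => ????; apply/andP; split; lra.
Qed.

Lemma innerDl u v w : inner (u + v) w = inner u w + inner v w.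
Proof.
rewrite /inner -csumD; [|exact: inner_csummable..].
by congr csum; apply/funext => x; rewrite -mulrDl.
Qed.

Lemma innerZl c u v : inner (c *: u) v = c * inner u v.
Proof.
rewrite /inner -csumZ; last exact: inner_csummable.
by congr csum; apply/funext => x; rewrite mulrA.
Qed.

Lemma innerC u v : inner v u = (inner u v)^*.
Proof.
rewrite /inner -csum_conj; congr csum; apply/funext => x.
by rewrite conjCM conjCK mulrC.
Qed.

Lemma innerDr u v w : inner u (v + w) = inner u v + inner u w.
Proof. by rewrite innerC innerDl conjCD -!innerC. Qed.

Lemma innerZr c u v : inner u (c *: v) = c^* * inner u v.
Proof. by rewrite innerC innerZl conjCM -innerC. Qed.

Lemma innerNl u v : inner (- u) v = - inner u v.
Proof. by rewrite -scaleN1r innerZl mulN1r. Qed.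

Lemma innerNr u v : inner u (- v) = - inner u v.
Proof. by rewrite innerC innerNl conjCN -innerC. Qed.

Lemma inner0l u : inner 0 u = 0.
Proof. by rewrite -(scale0r (0 : l2 R X)) innerZl mul0r. Qed.

Lemma inner0r u : inner u 0 = 0.
Proof. by rewrite innerC inner0l conjC0. Qed.

Lemma inner_deltal u x : inner (delta R x) u = (u x)^*.
Proof. by rewrite innerC inner_delta. Qed.

Lemma inner_normE u : inner u u = (l2norm u ^+ 2)%:C.
Proof. by rewrite inner_norm -rmorphXn. Qed.

Lemma l2norm_delta x : l2norm (delta R x) = 1.
Proof.
apply/eqP; rewrite -(@eqrXn2 _ 2%N) ?l2norm_ge0// expr1n; apply/eqP/complexI.
by rewrite -inner_normE inner_delta /= eqxx.
Qed.

Lemma cauchy_schwarz u v :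
  normsq (inner u v) <= l2norm u ^+ 2 * l2norm v ^+ 2.
Proof.
have [v0|v0] := eqVneq (l2norm v) 0.
  by rewrite (l2norm_eq0 v0) inner0r l2norm0 normsq0 expr0n /= mulr0.
have {}v0 : 0 < l2norm v ^+ 2 by rewrite exprn_gt0// lt_def v0 l2norm_ge0.
(* [w] is a multiple of the component of [u] orthogonal to [v]. Its squared norm is the wanted
   difference times the positive factor [l2norm v ^+ 2]. *)
set c := inner u v; pose w := (l2norm v ^+ 2)%:C *: u - c *: v.
have : (l2norm w ^+ 2)%:C =
    (l2norm v ^+ 2 * (l2norm u ^+ 2 * l2norm v ^+ 2 - normsq c))%:C.
  rewrite -inner_normE /w innerDl !innerDr !innerZl !innerNl !innerNr !innerZl.
  rewrite !innerZr !inner_normE -/c (innerC u v) -/c conjC_real.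
  rewrite real_complexM real_complexB real_complexM -mulr_conj; ring.
move=> /complexI e; rewrite -subr_ge0 -(pmulr_rge0 _ v0) -e; exact: sqr_ge0.
Qed.

Lemma normsq_le_l2norm u x : normsq (u x) <= l2norm u ^+ 2.
Proof. by rewrite -inner_delta (le_trans (cauchy_schwarz _ _))// l2norm_delta expr1n mulr1. Qed.

Lemma l2norm_remove u x :
  l2norm (u - u x *: delta R x) ^+ 2 = l2norm u ^+ 2 - normsq (u x).
Proof.
apply: complexI; rewrite -inner_normE innerDl !innerDr !innerNl !innerNr.
rewrite !innerZl !innerZr inner_delta inner_deltal !inner_normE l2norm_delta.
rewrite expr1n real_complexB -mulr_conj; ring.
Qed.

Definition truncation u (s : seq X) : l2 R X := \sum_(x <- s) u x *: delta R x.

Lemma truncationE u s y : uniq s -> truncation u s y = if y \in s then u y else 0.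
Proof.
rewrite /truncation; elim: s => [|x s IH] /=; first by rewrite big_nil.
move=> /andP[xs us]; rewrite big_cons.
rewrite -[LHS]/(u x * (y == x)%:R + (\sum_(x0 <- s) u x0 *: delta R x0 : l2 R X) y) IH// inE.
have [->|yx] /= := eqVneq y x; first by rewrite (negbTE xs) mulr1 addr0.
by rewrite mulr0 add0r.
Qed.

Lemma l2norm_truncation u s : uniq s ->
  l2norm (u - truncation u s) ^+ 2 = l2norm u ^+ 2 - \sum_(x <- s) normsq (u x).
Proof.
elim: s => [|x s IH]; first by rewrite /truncation !big_nil !subr0.
move=> /andP[xs us]; rewrite big_cons /truncation big_cons -/(truncation u s).
have e : (u - truncation u s) x = u x.
  by rewrite -[LHS]/(u x - truncation u s x) truncationE// (negbTE xs) subr0.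
rewrite [_ *: _ + _]addrC opprD addrA -[in u x *: _]e l2norm_remove e IH//.
by ring.
Qed.

Lemma truncation_approx u (eps : R) : 0 < eps ->
  exists2 s, uniq s & l2norm (u - truncation u s) ^+ 2 < eps.
Proof.
move=> e0.
have : ((l2norm u ^+ 2 - eps)%:E < l2sq u)%E.
  by rewrite l2sq_fin lte_fin gtrDl oppr_lt0.
move=> /ereal_sup_gt[_ [A [finA _] <-]].
rewrite (fsbig_finite _ _ finA) sumEFin lte_fin => H.
exists (finmap.enum_fset (fset_set A)); first exact: finmap.fset_uniq.
by rewrite l2norm_truncation; [rewrite ltrBlDl -ltrBlDr|exact: finmap.fset_uniq].
Qed.

(** Finite truncations are dense and [F] vanishes on them. This is the density principle behind the
    later arguments that check an identity on basis vectors only. *)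
Lemma bounded_functional_eq0 (F : l2 R X -> R[i]) (M : R) :
    (forall c u v, F (c *: u + v) = c * F u + F v) ->
    (forall u, normsq (F u) <= M * l2norm u ^+ 2) ->
    (forall x, F (delta R x) = 0) ->
  forall u, F u = 0.
Proof.
move=> lin bnd F0 u; apply: normsq_eq0; apply/eqP; rewrite eq_le normsq_ge0 andbT.
have FD v w : F (v + w) = F v + F w by rewrite -{1}[v]scale1r lin mul1r.
have F00 : F 0 = 0 by apply: (addrI (F 0)); rewrite -FD !addr0.
have FZ c v : F (c *: v) = c * F v by rewrite -[c *: v]addr0 lin F00 addr0.
have Ft s : F (truncation u s) = 0.
  rewrite /truncation; elim: s => [|x s IH]; first by rewrite big_nil.
  by rewrite big_cons FD FZ F0 IH mulr0 addr0.
apply/ler_addgt0Pr => e e0; rewrite add0r.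
have M1 : 0 < `|M| + 1 by rewrite ltr_wpDl.
have [s us H] := truncation_approx u (divr_gt0 e0 M1).
rewrite -[u](subrK (truncation u s)) FD Ft addr0 (le_trans (bnd _))//.
rewrite (@le_trans _ _ ((`|M| + 1) * l2norm (u - truncation u s) ^+ 2))//.
  by rewrite ler_wpM2r ?sqr_ge0// (le_trans (ler_norm _))// lerDl.
by rewrite mulrC -ler_pdivlMr// ltW.
Qed.

Lemma bounded_operator_normsq (T : l2 R X -> l2 R X) : bounded_operator T ->
  exists2 M : R, 0 <= M & forall u, l2norm (T u) ^+ 2 <= M * l2norm u ^+ 2.
Proof.
move=> [_ [M bM]]; exists (M ^+ 2); first exact: sqr_ge0.
move=> u; rewrite -exprMn.
have Mu : 0 <= M * l2norm u by rewrite (le_trans _ (bM u))// l2norm_ge0.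
by rewrite ler_sqr ?nnegrE ?l2norm_ge0.
Qed.

Lemma bounded_operatorD (T : l2 R X -> l2 R X) u v : bounded_operator T ->
  T (u + v) = T u + T v.
Proof. by move=> [lin _]; rewrite -{1}[u]scale1r lin scale1r. Qed.

Lemma bounded_operator0 (T : l2 R X -> l2 R X) : bounded_operator T -> T 0 = 0.
Proof.
by move=> bT; apply: (addrI (T 0)); rewrite -bounded_operatorD// !addr0.
Qed.

Lemma bounded_operatorZ (T : l2 R X -> l2 R X) c u : bounded_operator T ->
  T (c *: u) = c *: T u.
Proof.
by move=> bT; rewrite -[c *: u]addr0 bT.1 bounded_operator0// addr0.
Qed.

Lemma bounded_operator_delta_ext (T S : l2 R X -> l2 R X) :
    bounded_operator T -> bounded_operator S ->
    (forall x, T (delta R x) = S (delta R x)) -> T = S.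
Proof.
move=> bT bS TS; apply/funext => u; apply/val_inj/funext => x /=.
have [M M0 HM] := bounded_operator_normsq bT.
have [N N0 HN] := bounded_operator_normsq bS.
apply/eqP; rewrite -subr_eq0; apply/eqP.
(* The constant below comes from [normsqD] with [t = 1]. *)
apply: (@bounded_functional_eq0 (fun u => T u x - S u x)
  ((1 + 1) * M + (1 + 1^-1) * N)) => [c v w|v|y].
- rewrite bT.1 bS.1.
  rewrite -[(c *: T v + T w) x]/(c * T v x + T w x).
  rewrite -[(c *: S v + S w) x]/(c * S v x + S w x); ring.
- rewrite (le_trans (normsqD _ _ ltr01))// normsqN [leRHS]mulrDl -2!mulrA lerD//.
    by rewrite ler_wpM2l// ?addr_ge0// (le_trans (normsq_le_l2norm _ _)).
  rewrite ler_wpM2l// ?addr_ge0 ?invr_ge0//.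
  by rewrite (le_trans (normsq_le_l2norm _ _)).
- by rewrite TS subrr.
Qed.

(** Symmetry passes from basis vectors to all vectors one argument at a time: [bil] frees the left
    argument, first against a basis vector and then, after conjugation, against an arbitrary [v]. *)
Lemma bounded_hermitian (T : l2 R X -> l2 R X) : bounded_operator T ->
    (forall x y, T (delta R x) y = (T (delta R y) x)^*) -> is_adjoint T T.
Proof.
move=> bT herm.
have [M M0 HM] := bounded_operator_normsq bT.
have bil (v : l2 R X) :
    (forall x, inner (T (delta R x)) v = inner (delta R x) (T v)) ->
    forall u, inner (T u) v = inner u (T v).
  move=> H u; apply/eqP; rewrite -subr_eq0; apply/eqP.
  apply: (@bounded_functional_eq0 (fun u => inner (T u) v - inner u (T v))
    ((1 + 1) * (M * l2norm v ^+ 2) + (1 + 1^-1) * l2norm (T v) ^+ 2))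
    => [c w1 w2|w|y]; last by rewrite H subrr.
    rewrite bT.1 !innerDl !innerZl; ring.
  rewrite (le_trans (normsqD _ _ ltr01))// normsqN [leRHS]mulrDl lerD//.
    rewrite -mulrA.
    rewrite ler_wpM2l// ?addr_ge0// (le_trans (cauchy_schwarz _ _))//.
    by rewrite [leRHS]mulrAC ler_wpM2r ?sqr_ge0.
  rewrite -mulrA.
  rewrite ler_wpM2l// ?addr_ge0 ?invr_ge0// (le_trans (cauchy_schwarz _ _))//.
  by rewrite mulrC.
move=> u v; apply: (bil v) => x {u}.
have h : inner (T v) (delta R x) = inner v (T (delta R x)).
  by apply: bil => y; rewrite inner_delta inner_deltal; exact: herm.
by rewrite innerC -h -innerC.
Qed.

End inner_product_theory.

(** * Partial translations *)

Section l2_finite_sums.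
Variables (R : realType) (X : choiceType).
Implicit Types (x : X) (u : l2 R X) (s : seq X).

Lemma l2norm_le_sum u (M : R) :
    (forall s, uniq s -> \sum_(x <- s) normsq (u x) <= M) -> l2norm u ^+ 2 <= M.
Proof.
move=> H; rewrite -lee_fin -l2sq_fin; apply: ge_ereal_sup => _ [A [finA _] <-].
by rewrite (fsbig_finite _ _ finA) sumEFin lee_fin H// finmap.fset_uniq.
Qed.

Lemma normsq_small u (eps : R) : 0 < eps ->
  exists s : seq X, forall x, x \notin s -> normsq (u x) < eps.
Proof.
move=> e0; have [s us H] := truncation_approx u e0; exists s => x xs.
have -> : u x = (u - truncation u s) x.
  by rewrite -[RHS]/(u x - truncation u s x) truncationE// (negbTE xs) subr0.
by rewrite (le_lt_trans (normsq_le_l2norm _ x)).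
Qed.

End l2_finite_sums.

Section partial_translations.
Variables (R : realType) (X : choiceType).
Implicit Types (x y z : X) (u v : l2 R X).

Definition partial_injection (phi : X -> option X) :=
  forall x y z, phi x = Some z -> phi y = Some z -> x = y.

(** Here [phi] assigns to a point its source: the induced operator moves the basis vector at [y] to
    the one at [x] when [phi x = Some y]. *)
Definition pullback (phi : X -> option X) (u : X -> R[i]) : X -> R[i] :=
  fun x => if phi x is Some y then u y else 0.

Lemma l2sq_pullback phi (u : X -> R[i]) : partial_injection phi ->
  (l2sq (pullback phi u) <= l2sq u)%E.
Proof.
(* The sum is supported on the domain [D] of [phi], where [e] is injective, so it can be reindexed
   over the image of [D]. The default value of [e] is never met on [D]. *)
move=> inj_phi; pose e x := odflt x (phi x); pose D := [set x | isSome (phi x)].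
have -> : l2sq (pullback phi u) = (\esum_(x in D) (normsq (u (e x)))%:E)%E.
  rewrite [RHS]esum_mkcond; apply: eq_esum => x _; rewrite /pullback /e.
  have [xD|] := boolP (x \in D).
    by move: xD; rewrite inE /D /=; case: (phi x).
  by rewrite notin_setE /D /=; case: (phi x) => //= _; rewrite normsq0.
rewrite -(esum_image D e (fun y => (normsq (u y))%:E)).
  rewrite esum_mkcond; apply: le_esum => y _.
  by case: ifP; rewrite ?lee_fin ?normsq_ge0.
move=> x y; rewrite !inE /D /e /=.
case Ex: (phi x) => [a|] //; case Ey: (phi y) => [b|] //= _ _ ab.
by rewrite ab in Ex; exact: inj_phi Ex Ey.
Qed.

Lemma pullback_square_summable phi u : partial_injection phi ->
  pullback phi u \in @square_summable R X.
Proof.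
move=> inj_phi; rewrite inE (le_lt_trans (l2sq_pullback u inj_phi))//.
exact: l2_funP.
Qed.

Definition ptrans phi (inj_phi : partial_injection phi) (u : l2 R X) : l2 R X :=
  L2 (pullback_square_summable u inj_phi).

Lemma ptransE phi (inj_phi : partial_injection phi) u x :
  ptrans inj_phi u x = if phi x is Some y then u y else 0.
Proof. by []. Qed.

Lemma ptrans_delta phi (inj_phi : partial_injection phi) x y :
  ptrans inj_phi (delta R x) y = (phi y == Some x)%:R.
Proof. by rewrite ptransE; case: (phi y). Qed.

Lemma ptrans_bounded phi (inj_phi : partial_injection phi) :
  bounded_operator (ptrans inj_phi).
Proof.
split.
  move=> c u v; apply/val_inj/funext => x.
  rewrite -[LHS]/(ptrans inj_phi (c *: u + v) x).
  rewrite -[RHS]/(c * ptrans inj_phi u x + ptrans inj_phi v x) !ptransE.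
  by case: (phi x) => //; rewrite mulr0 addr0.
exists 1 => u; rewrite mul1r -ler_sqr ?nnegrE ?l2norm_ge0//.
by rewrite -lee_fin -!l2sq_fin; exact: l2sq_pullback.
Qed.

Lemma bounded_supp_uniform_roe (E : set (set (X * X))) (T : l2 R X -> l2 R X) :
  bounded_operator T -> E (supp T) -> uniform_roe R E T.
Proof.
move=> bT ET; split=> // eps e0; exists T; split=> //.
rewrite /opnorm (_ : [set _ | _ in _] = [set 0]) ?sup1//.
apply/seteqP; split => [_ [u _ <-]|_ ->]; first by rewrite /= subrr l2norm0.
by exists 0; rewrite /= ?subrr l2norm0.
Qed.

Lemma ptrans_uniform_roe (E : set (set (X * X))) phi
    (inj_phi : partial_injection phi) : coarse_structure E ->
  E [set xy | phi xy.2 = Some xy.1] -> uniform_roe R E (ptrans inj_phi).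
Proof.
move=> cE Ephi; apply: bounded_supp_uniform_roe; first exact: ptrans_bounded.
apply: (coarse_subset cE) Ephi => -[x y]; rewrite /supp /= inner_delta ptrans_delta.
by case: (phi y =P Some x) => //= _ /eqP[].
Qed.

Lemma bounded_operatorB (S T : l2 R X -> l2 R X) :
  bounded_operator S -> bounded_operator T -> bounded_operator (S \- T).
Proof.
move=> [linS [M HM]] [linT [N HN]]; split.
  move=> c u v; rewrite -[LHS]/(S (c *: u + v) - T (c *: u + v)) linS linT.
  by rewrite -[RHS]/(c *: (S u - T u) + (S v - T v)) scalerBr opprD addrACA.
exists (M + N) => u; rewrite mulrDl (le_trans (l2normD _ _))// lerD//.
rewrite -scaleN1r l2normZ (_ : Num.sqrt _ = 1) ?mul1r//.
by rewrite normsqN normsq1 sqrtr1.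
Qed.

Lemma le_opnorm (T : l2 R X -> l2 R X) u : bounded_operator T ->
  l2norm u <= 1 -> l2norm (T u) <= opnorm T.
Proof.
move=> [_ [M HM]] u1; apply: ub_le_sup; last by exists u.
exists `|M| => _ [v v1 <-]; rewrite (le_trans (HM v))//.
rewrite (le_trans (ler_wpM2r (l2norm_ge0 _) (ler_norm M)))//.
by rewrite ler_piMr.
Qed.

(** Off the support of an approximant [S], the entries of [T] are entries of [T \- S], hence bounded
    by its norm. The square root of [eps] appears because [normsq] is a squared modulus. *)
Lemma uniform_roe_entry (E : set (set (X * X))) (T : l2 R X -> l2 R X) (eps : R) :
    uniform_roe R E T -> 0 < eps ->
  exists2 A, E A & forall x y, ~ A (x, y) -> normsq (T (delta R x) y) < eps.
Proof.
move=> [bT H] e0; have [S [bS ES TS]] := H (Num.sqrt eps) (etrans (sqrtr_gt0 _) e0).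
exists (supp S) => // x y; rewrite /supp /= inner_delta => /negP/negPn/eqP Sxy.
have bTS := bounded_operatorB bT bS.
have le : l2norm ((T \- S) (delta R x)) ^+ 2 < eps.
  rewrite -(sqr_sqrtr (ltW e0)) ltr_pXn2r ?nnegrE ?l2norm_ge0 ?sqrtr_ge0//.
  by rewrite (le_lt_trans _ TS)// le_opnorm// l2norm_delta.
have -> : T (delta R x) y = (T \- S) (delta R x) y.
  by rewrite -[RHS]/(T (delta R x) y - S (delta R x) y) Sxy subr0.
by rewrite (le_lt_trans (normsq_le_l2norm _ y)).
Qed.

End partial_translations.

(** * Entourages of a metric space *)

Section bounded_coarse_structure.
Variables (R : realType) (X : metricType R).

Lemma bounded_coarseP (A : set (X * X)) : bounded_coarse X A <->
  exists r : R, forall x y, A (x, y) -> mdist x y <= r.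
Proof.
split=> [|[r Ar]]; last first.
  (* Generators have nonnegative radius, whereas [r] may be negative when [A] is empty; hence the
     maximum with 0. *)
  apply: (coarse_subset (bounded_coarse_structure X)
    (B := [set xy | mdist xy.1 xy.2 <= Num.max 0 r])).
    by move=> [x y] /Ar; rewrite /= le_max => ->; rewrite orbT.
  by apply: sub_gen_smallest; exists (Num.max 0 r) => //; rewrite le_max lexx.
(* The sets of bounded displacement form a coarse structure containing the generators, so they
   contain the smallest one. *)
apply: (smallest_sub (X := [set A | exists r : R, forall x y, A (x, y) -> mdist x y <= r]));
  last by move=> _ [r r0 ->]; exists r.
split.
- by exists 0 => x y /= xy; rewrite (xy : x = y) mdistxx.
- by move=> B C BC [r Cr]; exists r => x y /BC/Cr.
- by move=> B [r Br]; exists r => x y /= /Br; rewrite metric_sym.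
- move=> B C [r Br] [t Ct]; exists (Num.max r t) => x y.
  by rewrite le_max; case=> [/Br|/Ct] ->//; rewrite orbT.
- move=> B C [r Br] [t Ct]; exists (r + t) => x y [z xz zy].
  exact: le_trans (metric_triangle x z y) (lerD (Br x z xz) (Ct z y zy)).
Qed.

Lemma finite_ball (ulf : uniformly_locally_finite (bounded_coarse X)) (r : R) x :
  exists s : seq X, forall y, mdist x y <= r -> y \in s.
Proof.
have [|n Hn] := ulf [set xy | mdist xy.1 xy.2 <= r].
  by apply/bounded_coarseP; exists r.
have fin : finite_set [set y | mdist x y <= r].
  exact: card_le_finite (Hn x) (finite_II n).
exists (finmap.enum_fset (fset_set [set y | mdist x y <= r])) => y xy.
by rewrite in_fset_set// inE.
Qed.

End bounded_coarse_structure.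

(** * The uniform Roe algebra *)

Section uniform_roe_algebra.
Variables (R : realType) (X : choiceType).
Implicit Types (x y : X) (u v : l2 R X) (S T : l2 R X -> l2 R X).

Lemma l2ZE (c : R[i]) u x : (c *: u) x = c * u x.
Proof. by []. Qed.

Lemma l2norm_opnorm T u : bounded_operator T -> l2norm (T u) <= opnorm T * l2norm u.
Proof.
move=> bT; have [u0|u0] := eqVneq (l2norm u) 0.
  by rewrite (l2norm_eq0 u0) bounded_operator0// l2norm0 mulr0.
have {}u0 : 0 < l2norm u by rewrite lt_def u0 l2norm_ge0.
pose c : R[i] := (l2norm u)^-1%:C.
have nc v : l2norm (c *: v) = (l2norm u)^-1 * l2norm v.
  rewrite l2normZ /normsq /= expr0n /= addr0 sqrtr_sqr ger0_norm//.
  by rewrite invr_ge0 l2norm_ge0.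
rewrite -ler_pdivrMr// mulrC -nc -(bounded_operatorZ _ _ bT).
by apply: le_opnorm => //; rewrite nc mulVf// gt_eqF.
Qed.

Lemma opnorm_ge0 T : bounded_operator T -> 0 <= opnorm T.
Proof.
move=> bT; rewrite (le_trans (l2norm_ge0 (T 0)))// le_opnorm//.
by rewrite l2norm0.
Qed.

Lemma opnorm_le T (M : R) : (forall u, l2norm u <= 1 -> l2norm (T u) <= M) ->
  opnorm T <= M.
Proof.
move=> H; apply: ge_sup; first by exists (l2norm (T 0)), 0; rewrite /= ?l2norm0.
by move=> _ [u u1 <-]; exact: H.
Qed.

Lemma bounded_operator_comp S T : bounded_operator S -> bounded_operator T ->
  bounded_operator (S \o T).
Proof.
move=> bS bT; split; first by move=> c u v; rewrite /= bT.1 bS.1.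
exists (opnorm S * opnorm T) => u /=; rewrite (le_trans (l2norm_opnorm _ bS))//.
by rewrite -mulrA ler_wpM2l ?opnorm_ge0// l2norm_opnorm.
Qed.

Lemma scale_bounded (c : R[i]) : bounded_operator (fun u : l2 R X => c *: u).
Proof.
split; last by exists (Num.sqrt (normsq c)) => u; rewrite l2normZ.
by move=> a u v; rewrite scalerDr !scalerA mulrC.
Qed.

Lemma rank1_bounded v w : bounded_operator (fun u : l2 R X => inner u v *: w).
Proof.
split; first by move=> a u u'; rewrite innerDl innerZl scalerDl scalerA.
exists (l2norm v * l2norm w) => u.
rewrite l2normZ mulrAC ler_wpM2r ?l2norm_ge0//.
rewrite -ler_sqr ?nnegrE ?mulr_ge0 ?l2norm_ge0 ?sqrtr_ge0//.
rewrite sqr_sqrtr ?normsq_ge0// exprMn mulrC; exact: cauchy_schwarz.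
Qed.

Lemma partial_injection_res (D : set X) :
  partial_injection (fun x => if x \in D then Some x else None).
Proof. by move=> x y z; case: ifP => // _ [->]; case: ifP => // _ [->]. Qed.

Definition restriction (D : set X) : l2 R X -> l2 R X :=
  ptrans (@partial_injection_res D).

Lemma restrictionE (D : set X) u x : restriction D u x = if x \in D then u x else 0.
Proof. by rewrite /restriction ptransE; case: ifP. Qed.

Lemma restriction_bounded (D : set X) : bounded_operator (restriction D).
Proof. exact: ptrans_bounded. Qed.

Lemma supp_comp S T : bounded_operator S -> bounded_operator T ->
  supp (S \o T) `<=` (supp S \; supp T)%relation.
Proof.
move=> bS bT [x y]; rewrite /supp /= inner_delta; apply: contraPP => H.
apply/negP/negPn/eqP; set v := T (delta R x).
have [M M0 HM] := bounded_operator_normsq bS.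
(* The functional [u |-> S (restriction D u) y] kills every basis vector: outside [D] the
   restriction is zero, and a point [z] of [D] with a nonzero entry would be an intermediate point
   between [x] and [y]. *)
pose D := [set z | v z != 0].
have -> : v = restriction D v.
  apply/val_inj/funext => z; rewrite -[RHS]/(restriction D v z) restrictionE.
  by case: (boolP (z \in D)) => //; rewrite /D notin_setE /= => /negP/negPn/eqP.
apply: (@bounded_functional_eq0 _ _ (fun u => S (restriction D u) y) M) => [c u w|u|z].
- by by rewrite (restriction_bounded D).1 bS.1.
- rewrite (le_trans (normsq_le_l2norm _ _))// (le_trans (HM _))//.
  rewrite ler_wpM2l// -lee_fin -!l2sq_fin; exact: (l2sq_pullback u (@partial_injection_res D)).
- have [zD|zD] := boolP (z \in D); last first.
    suff -> : restriction D (delta R z) = 0 by rewrite bounded_operator0.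
    apply/val_inj/funext => t; rewrite -[LHS]/(restriction D (delta R z) t).
    by rewrite restrictionE /=; case: eqP => [->|]; rewrite ?(negbTE zD)//; case: ifP.
  have -> : restriction D (delta R z) = delta R z.
    apply/val_inj/funext => t; rewrite -[LHS]/(restriction D (delta R z) t).
    by rewrite restrictionE /=; case: eqP => [->|]; rewrite ?zD//; case: ifP.
  apply/eqP/negPn/negP => Sz; apply: H; exists z => //=.
    by rewrite inner_delta; move: zD; rewrite inE.
  by rewrite inner_delta.
Qed.

Lemma uniform_roe_comp (E : set (set (X * X))) S T : coarse_structure E ->
  uniform_roe R E S -> uniform_roe R E T -> uniform_roe R E (S \o T).
Proof.
move=> cE [bS HS] [bT HT]; split; first exact: bounded_operator_comp.
move=> eps e0.
(* [T'] is chosen before [S'], because the error term [(S \- S') \o T'] involves the norm of [T'].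
   The added 1 keeps the denominators positive, and [eps / 2 + eps / 4] leaves room for a strict
   bound. *)
have S1 : 0 < opnorm S + 1 by rewrite ltr_wpDl ?opnorm_ge0.
have e1 : 0 < eps / 2 / (opnorm S + 1) by rewrite !divr_gt0.
have [T' [bT' ET' TT']] := HT _ e1.
have T1 : 0 < opnorm T' + 1 by rewrite ltr_wpDl ?opnorm_ge0.
have e2 : 0 < eps / 4 / (opnorm T' + 1) by rewrite !divr_gt0.
have [S' [bS' ES' SS']] := HS _ e2.
exists (S' \o T'); split; first exact: bounded_operator_comp.
  apply: (coarse_subset cE (supp_comp bS' bT')); exact: (coarse_compose cE).
apply: (@le_lt_trans _ _ (eps / 2 + eps / 4)); last first.
  rewrite {3}(_ : eps = eps / 2 + eps / 2) ?ltrD2l; last by field.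
  by rewrite ltr_pM2l// ltf_pV2 ?posrE// ltr_nat.
apply: opnorm_le => u u1 /=.
have -> : S (T u) - S' (T' u) = S ((T \- T') u) + (S \- S') (T' u).
  rewrite -[(T \- T') u]/(T u - T' u) -[(S \- S') _]/(S (T' u) - S' (T' u)).
  rewrite -[- T' u]scaleN1r (bounded_operatorD _ _ bS) (bounded_operatorZ _ _ bS) scaleN1r.
  by rewrite addrA subrK.
rewrite (le_trans (l2normD _ _))// lerD//.
  rewrite (le_trans (l2norm_opnorm _ bS))//.
  rewrite -(@divfK _ (opnorm S + 1) _ (eps / 2)) ?gt_eqF// mulrC.
  rewrite ler_pM ?l2norm_ge0 ?opnorm_ge0// ?lerDl//.
  by rewrite (le_trans _ (ltW TT'))// le_opnorm//; exact: bounded_operatorB.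
rewrite (le_trans (l2norm_opnorm _ (bounded_operatorB bS bS')))//.
rewrite -(@divfK _ (opnorm T' + 1) _ (eps / 4)) ?gt_eqF//.
rewrite ler_pM ?l2norm_ge0 ?opnorm_ge0//; [exact: bounded_operatorB|exact: ltW|].
by rewrite (le_trans (le_opnorm bT' u1))// lerDl.
Qed.

(** Multiplication by [c] is itself an operator supported on the diagonal, so this is an instance of
    closure under composition. *)
Lemma uniform_roe_scale (E : set (set (X * X))) (c : R[i]) T : coarse_structure E ->
  uniform_roe R E T -> uniform_roe R E (c \*: T).
Proof.
move=> cE ET; rewrite -[c \*: T]/((fun u => c *: u) \o T).
refine (uniform_roe_comp cE _ ET).
apply: bounded_supp_uniform_roe; first exact: scale_bounded.
apply: (coarse_subset cE) (coarse_diagonal cE) => -[x y].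
rewrite /supp /= inner_delta -[(c *: delta R x) y]/(c * (y == x)%:R).
by rewrite /diagonal /=; case: (y =P x) => // _; rewrite mulr0 eqxx.
Qed.

Lemma partial_injection_unit x x' :
  partial_injection (fun z => if z == x then Some x' else None).
Proof. by move=> a b c; case: eqP => // -> _; case: eqP => // ->. Qed.

Definition munit x x' : l2 R X -> l2 R X := ptrans (@partial_injection_unit x x').

Lemma munitE x x' u : munit x x' u = u x' *: delta R x.
Proof.
apply/val_inj/funext => z; rewrite -[LHS]/(munit x x' u z) /munit ptransE.
rewrite -[RHS]/(u x' * (z == x)%:R).
by case: eqP; rewrite ?mulr1 ?mulr0.
Qed.

(** Matrix entries are thus expressed by products and scalars alone, so a multiplicative homogeneous
    map transports them. *)
Lemma munit_sandwich x x' y y' T : bounded_operator T ->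
  munit x y \o (T \o munit x' y') = T (delta R x') y \*: munit x y'.
Proof.
move=> bT; apply/funext => u; rewrite /= !munitE (bounded_operatorZ _ _ bT).
by rewrite l2ZE [RHS]scalerA mulrC.
Qed.

Lemma munit_comp x y z : munit x y \o munit y z = munit x z.
Proof.
by apply/funext => u; rewrite /= !munitE l2ZE /= eqxx mulr1.
Qed.

Lemma munit_adjoint x y : is_adjoint (munit x y) (munit y x).
Proof.
by move=> u v; rewrite !munitE innerZl innerZr inner_deltal inner_delta mulrC.
Qed.

End uniform_roe_algebra.

(** * Vectors implementing an isomorphism *)

Section bounded_roe.
Variables (R : realType) (X : metricType R).
Implicit Types (S T : l2 R X -> l2 R X).

Definition roe : set (l2 R X -> l2 R X) := uniform_roe R (bounded_coarse X).

Lemma roe_bounded T : roe T -> bounded_operator T.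
Proof. by case. Qed.

Lemma roe_comp S T : roe S -> roe T -> roe (S \o T).
Proof. exact: uniform_roe_comp (bounded_coarse_structure X). Qed.

Lemma roe_scale (c : R[i]) T : roe T -> roe (c \*: T).
Proof. exact: uniform_roe_scale (bounded_coarse_structure X). Qed.

Lemma roe_ptrans phi (inj_phi : partial_injection phi) (r : R) :
  (forall x y, phi y = Some x -> mdist x y <= r) -> roe (ptrans inj_phi).
Proof.
move=> H; apply: ptrans_uniform_roe; first exact: bounded_coarse_structure.
by apply/bounded_coarseP; exists r => x y; exact: H.
Qed.

Lemma roe_munit (x y : X) : roe (munit x y).
Proof.
apply: (@roe_ptrans _ _ (mdist y x)) => a b.
by case: eqP => // -> [<-].
Qed.

(** The zero operator is written as a zero multiple of [munit x y], the form to which homogeneity of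
    the isomorphism applies. *)
Lemma munit_neq0 (x y : X) : munit x y <> (0 : R[i]) \*: munit x y.
Proof.
move=> /(congr1 (fun T => T (delta R y))); rewrite /= scale0r munitE /= eqxx.
rewrite scale1r => /(congr1 (@l2norm R X)); rewrite l2norm0 l2norm_delta.
by move/eqP; rewrite oner_eq0.
Qed.

End bounded_roe.
Arguments roe {R} X.

(** This interface is established both for the isomorphism and for its inverse, so each later
    estimate is available in both directions. *)
Record spatial (R : realType) (X Y : metricType R)
    (Psi : (l2 R X -> l2 R X) -> (l2 R Y -> l2 R Y)) (xi : X -> l2 R Y) : Prop :=
  Spatial {
    spatial_roe : forall T, roe X T -> roe Y (Psi T);
    spatial_comp : forall S T, roe X S -> roe X T -> Psi (S \o T) = Psi S \o Psi T;
    spatial_scale : forall (c : R[i]) T, roe X T -> Psi (c \*: T) = c \*: Psi T;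
    spatial_munit : forall x x' u, Psi (munit x x') u = inner u (xi x') *: xi x;
    spatial_norm : forall x, l2norm (xi x) = 1 }.

Section spatial_theory.
Variables (R : realType) (X Y : metricType R).
Variables (Psi : (l2 R X -> l2 R X) -> (l2 R Y -> l2 R Y)) (xi : X -> l2 R Y).
Hypothesis sp : spatial Psi xi.

Lemma spatial_inner x : inner (xi x) (xi x) = 1.
Proof. by rewrite inner_normE (spatial_norm sp) expr1n. Qed.

Lemma spatial_neq0 x : xi x != 0.
Proof.
apply/eqP => x0; have := spatial_norm sp x; rewrite x0 l2norm0 => /eqP.
by rewrite eq_sym oner_eq0.
Qed.

(** The image under [Psi] of the sandwich identity for [munit x x \o (T \o munit x' x')] is
    evaluated at [xi x']; both sides are multiples of the nonzero vector [xi x]. *)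
Lemma spatial_entry T x x' : roe X T ->
  T (delta R x') x = inner (Psi T (xi x')) (xi x).
Proof.
move=> rT; have bT := roe_bounded rT.
have bPT := roe_bounded (spatial_roe sp rT).
have := congr1 Psi (munit_sandwich x x' x x' bT).
rewrite (spatial_scale sp _ (roe_munit x x')).
rewrite (spatial_comp sp (roe_munit x x) (roe_comp rT (roe_munit x' x'))).
rewrite (spatial_comp sp rT (roe_munit x' x')).
move=> /(congr1 (fun S => S (xi x'))) /=.
rewrite !(spatial_munit sp) spatial_inner !scale1r.
move=> /eqP; rewrite -subr_eq0 -scalerBl scaler_eq0 (negbTE (spatial_neq0 x)) orbF.
by rewrite subr_eq0 => /eqP.
Qed.

Lemma spatial_orthogonal x x' : x != x' -> inner (xi x') (xi x) = 0.
Proof.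
move=> xx'; have := spatial_entry x x' (roe_munit x' x').
rewrite munitE l2ZE (spatial_munit sp) spatial_inner scale1r => <-.
by rewrite /= eqxx mul1r (negbTE xx').
Qed.

End spatial_theory.

(** * Extraction of the vectors from the isomorphism and its inverse *)

Section spatial_implementation.
Variables (R : realType) (X Y : metricType R).
Variables (Phi : (l2 R X -> l2 R X) -> (l2 R Y -> l2 R Y)).
Hypothesis Phi_bij : set_bij (roe X) (roe Y) Phi.
Hypothesis Phi_scale : forall (c : R[i]) T, roe X T -> Phi (c \*: T) = c \*: Phi T.
Hypothesis Phi_comp : forall S T, roe X S -> roe X T -> Phi (S \o T) = Phi S \o Phi T.
Hypothesis Phi_adj : forall S T, roe X S -> roe X T -> is_adjoint T S ->
  is_adjoint (Phi T) (Phi S).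

Lemma Phi_roe T : roe X T -> roe Y (Phi T).
Proof. by case: Phi_bij => H _ _; exact: H. Qed.

Lemma Phi_inj S T : roe X S -> roe X T -> Phi S = Phi T -> S = T.
Proof. by case: Phi_bij => _ H _ XS XT; apply: H; rewrite inE. Qed.

Lemma Phi_surj S : roe Y S -> exists2 T, roe X T & Phi T = S.
Proof. by case: Phi_bij => _ _ H /H. Qed.

(* Write p = Phi e_00. Minimality makes p e_yy p a scalar multiple of p, and
   p e_yy p u = <u, p delta_y> p delta_y. *)
Lemma minimal_rank1 (x0 : X) : exists2 w : l2 R Y, inner w w = 1 &
  forall u, Phi (munit x0 x0) u = inner u w *: w.
Proof.
set p := Phi (munit x0 x0).
have rp : roe Y p by apply: Phi_roe; exact: roe_munit.
have bp := roe_bounded rp.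
have padj : is_adjoint p p.
  by apply: Phi_adj; [exact: roe_munit..|exact: munit_adjoint].
have pp u : p (p u) = p u.
  have := Phi_comp (roe_munit x0 x0) (roe_munit x0 x0).
  by rewrite munit_comp => /(congr1 (fun S => S u)).
(* If [p] killed all basis vectors it would vanish by self-adjointness, against the injectivity of
   [Phi]. *)
have [y py0] : exists y, p (delta R y) <> 0.
  apply: contrapT => H; apply: (@munit_neq0 R X x0 x0).
  apply: Phi_inj; [exact: roe_munit|apply: roe_scale; exact: roe_munit|].
  rewrite Phi_scale; last exact: roe_munit.
  rewrite -/p; apply/funext => u; rewrite /= scale0r; apply/val_inj/funext => y /=.
  rewrite -inner_delta padj (_ : p _ = 0) ?inner0r//.
  by apply: contrapT => py; apply: H; exists y.
set v := p (delta R y) in py0.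
have pv : p v = v by exact: pp.
have vy : v y = inner v v by rewrite -inner_delta -{1}pv padj.
have v0 : inner v v != 0.
  rewrite inner_normE; apply/eqP => -[/eqP]; rewrite sqrf_eq0 => /eqP n0.
  exact/py0/l2norm_eq0.
have [T rT TE] := Phi_surj (roe_munit y y).
have sand u : inner u v *: v = T (delta R x0) x0 *: p u.
  have := congr1 Phi (munit_sandwich x0 x0 x0 x0 (roe_bounded rT)).
  rewrite (Phi_scale _ (roe_munit x0 x0)).
  rewrite (Phi_comp (roe_munit x0 x0) (roe_comp rT (roe_munit x0 x0))).
  rewrite (Phi_comp rT (roe_munit x0 x0)).
  rewrite TE -/p => /(congr1 (fun S => S u)) /=.
  by rewrite munitE (bounded_operatorZ _ _ bp) -inner_delta padj -/v.
(* Evaluating [sand] at [v], which [p] fixes, determines the scalar; normalizing [v] then gives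
   [w]. *)
have lam : T (delta R x0) x0 = inner v v.
  have := sand v; rewrite pv => /eqP; rewrite -subr_eq0 -scalerBl scaler_eq0.
  by rewrite (introF eqP py0) orbF subr_eq0 eq_sym => /eqP.
have nv : l2norm v != 0 by apply/eqP => /l2norm_eq0.
have cR : ((l2norm v)^-1%:C : R[i])^* = (l2norm v)^-1%:C by exact: conjC_real.
have cc : (l2norm v)^-1%:C * (l2norm v)^-1%:C * inner v v = 1 :> R[i].
  by rewrite inner_normE -!real_complexM -expr2 -exprMn mulVf// expr1n.
exists ((l2norm v)^-1%:C *: v); first by rewrite innerZl innerZr cR mulrA.
move=> u; rewrite innerZr scalerA cR mulrAC -scalerA sand lam scalerA.
by rewrite cc scale1r.
Qed.

(** The unit vector [w] spanning the range of the image of [munit x0 x0] is transported by the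
    images of [munit x x0]. Factoring [munit x x'] through [x0] and taking adjoints gives the rank
    one formula. *)
Lemma spatial_Phi (x0 : X) : exists xi, spatial Phi xi.
Proof.
have [w w1 pw] := minimal_rank1 x0.
pose xi x := Phi (munit x x0) w.
have adj x y : is_adjoint (Phi (munit x y)) (Phi (munit y x)).
  by apply: Phi_adj; [exact: roe_munit..|exact: munit_adjoint].
have b x y := roe_bounded (Phi_roe (roe_munit x y)).
exists xi; split.
- exact: Phi_roe.
- exact: Phi_comp.
- exact: Phi_scale.
- move=> x x' u; rewrite -(munit_comp R x x0 x') -(munit_comp R x0 x0 x').
  rewrite (Phi_comp (roe_munit x x0) (roe_comp (roe_munit x0 x0) (roe_munit x0 x'))).
  rewrite (Phi_comp (roe_munit x0 x0) (roe_munit x0 x')).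
  by rewrite /= pw (bounded_operatorZ _ _ (b x x0)) adj.
- move=> x; apply/eqP; rewrite -(@eqrXn2 _ 2%N) ?l2norm_ge0// expr1n; apply/eqP.
  apply: complexI; rewrite -inner_normE /xi adj.
  rewrite -[Phi (munit x0 x) _]/((Phi (munit x0 x) \o Phi (munit x x0)) w).
  rewrite -Phi_comp; [|exact: roe_munit..].
  by rewrite munit_comp pw w1 scale1r w1.
Qed.

Lemma spatial_inverse (x0 : X) : exists Psi xi eta,
  [/\ spatial Phi xi, spatial Psi eta,
    forall T, roe X T -> Psi (Phi T) = T,
    forall S, roe Y S -> Phi (Psi S) = S &
    forall x y, eta y x = (xi x y)^*].
Proof.
have [xi sp] := spatial_Phi x0.
have /choice[Psi HPsi] : forall S, exists T, roe Y S -> roe X T /\ Phi T = S.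
  move=> S; have [/Phi_surj[T XT TS]|nS] := pselect (roe Y S); first by exists T.
  by exists (fun u => u) => /nS.
have rPsi S : roe Y S -> roe X (Psi S) by move=> /HPsi[].
have PhiPsi S : roe Y S -> Phi (Psi S) = S by move=> /HPsi[].
have PsiPhi T : roe X T -> Psi (Phi T) = T.
  by move=> rT; have rP := Phi_roe rT; exact: (Phi_inj (rPsi _ rP) rT (PhiPsi _ rP)).
have Psi_comp S T : roe Y S -> roe Y T -> Psi (S \o T) = Psi S \o Psi T.
  move=> rS rT; have rST := roe_comp rS rT.
  apply: (Phi_inj (rPsi _ rST) (roe_comp (rPsi _ rS) (rPsi _ rT))).
  by rewrite (Phi_comp (rPsi _ rS) (rPsi _ rT)) (PhiPsi _ rST) (PhiPsi _ rS) (PhiPsi _ rT).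
have Psi_scale (c : R[i]) T : roe Y T -> Psi (c \*: T) = c \*: Psi T.
  move=> rT; have rcT := roe_scale c rT.
  apply: (Phi_inj (rPsi _ rcT) (roe_scale c (rPsi _ rT))).
  by rewrite (Phi_scale _ (rPsi _ rT)) (PhiPsi _ rcT) (PhiPsi _ rT).
have [y0 xi0] : exists y0, xi x0 y0 != 0.
  apply: contrapT => H; have := spatial_neq0 sp x0 => /eqP; apply.
  apply/val_inj/funext => y /=; apply: contrapT => /eqP xiy; apply: H.
  by exists y.
have entry y y' x x' : Psi (munit y y') (delta R x') x = xi x' y' * (xi x y)^*.
  have rm := roe_munit y y'; rewrite (spatial_entry sp _ _ (rPsi _ rm)).
  by rewrite (PhiPsi _ rm) munitE innerZl inner_deltal.
(* By [entry], the column of [Psi (munit y y0)] at [x0] is the conjugate of [xi x y] scaled by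
   [xi x0 y0]; dividing by this nonzero scalar also shows that the conjugates form a square summable
   family. *)
have [eta etaE] : exists eta : Y -> l2 R X, forall x y, eta y x = (xi x y)^*.
  exists (fun y => (xi x0 y0)^-1 *: Psi (munit y y0) (delta R x0)) => x y.
  by rewrite l2ZE entry mulrA mulVf// mul1r.
have Psi_munit y y' u : Psi (munit y y') u = inner u (eta y') *: eta y.
  suff -> : Psi (munit y y') = fun u => inner u (eta y') *: eta y by [].
  apply: (bounded_operator_delta_ext (roe_bounded (rPsi _ (roe_munit y y')))
    (rank1_bounded _ _)).
  move=> x'; apply/val_inj/funext => x; apply: (etrans (entry _ _ _ _)).
  have -> : \val (inner (delta R x') (eta y') *: eta y) x =
    inner (delta R x') (eta y') * eta y x by exact: l2ZE.
  by rewrite inner_deltal (etaE x' y') (etaE x y) conjCK.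
have rm (y : Y) := roe_munit y y.
exists Psi, xi, eta; split=> //; split=> // y.
have eta0 : eta y != 0.
  apply/eqP => e0; apply: (@munit_neq0 R Y y y).
  rewrite -[in RHS](PhiPsi _ (rm y)) -(Phi_scale _ (rPsi _ (rm y))).
  rewrite -[LHS](PhiPsi _ (rm y)).
  by congr Phi; apply/funext => u; rewrite /= Psi_munit e0 !scaler0.
have n0 : l2norm (eta y) != 0 by apply: contra eta0 => /eqP /l2norm_eq0 ->.
(* Idempotence of [munit y y], read at [eta y], says that the squared norm of [eta y] equals its own
   square. Being nonzero, it is 1. *)
have := Psi_comp _ _ (rm y) (rm y); rewrite munit_comp.
move=> /(congr1 (fun S => S (eta y))) /=; rewrite !Psi_munit innerZl => /eqP.
rewrite -subr_eq0 -scalerBl scaler_eq0 (negbTE eta0) orbF inner_normE.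
rewrite -real_complexM -real_complexB => /eqP/complexI/eqP; rewrite -{1}[l2norm _ ^+ 2]mulr1 -mulrBr.
rewrite mulf_eq0 sqrf_eq0 (negbTE n0) subr_eq0 /= => /eqP n1.
by apply/eqP; rewrite -(@eqrXn2 _ 2%N) ?l2norm_ge0// expr1n -n1.
Qed.

End spatial_implementation.

(** * Sparse sequences *)

(** Dependent choice where each term may depend on the whole list of earlier terms; [pre n] is that
    list. *)
Lemma sequence_avoiding (T : Type) (P : seq T -> T -> Prop) :
  (forall s, exists x, P s x) -> exists a : nat -> T, forall n, P (mkseq a n) (a n).
Proof.
move=> /choice[g Pg].
pose pre := fix pre n := if n is m.+1 then rcons (pre m) (g (pre m)) else [::].
exists (fun n => g (pre n)) => n; rewrite (_ : mkseq _ n = pre n)//.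
by elim: n => // n IH; rewrite mkseqS IH.
Qed.

Lemma sum_subset_le (R : realType) (I : eqType) (s s' : seq I) (f : I -> R) :
    (forall i, 0 <= f i) -> uniq s -> uniq s' -> {subset s <= s'} ->
  \sum_(i <- s) f i <= \sum_(i <- s') f i.
Proof.
move=> f0 us us' ss'.
have p : perm_eq s [seq i <- s' | i \in s].
  apply: uniq_perm => //; first exact: filter_uniq.
  by move=> i; rewrite mem_filter; case: (boolP (i \in s)) => //= /ss' ->.
rewrite (perm_big _ p) big_filter big_mkcond; apply: ler_sum => i _.
by case: ifP.
Qed.

Section geometric_sums.
Variable R : realType.
Implicit Types f : nat -> R.

Lemma geometric_sum_le N : \sum_(i < N) (2^-1 : R) ^+ i <= 2.
Proof.
suff -> : \sum_(i < N) (2^-1 : R) ^+ i = 2 - 2 * 2^-1 ^+ N.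
  by rewrite gerBl mulr_ge0// exprn_ge0// invr_ge0.
elim: N => [|N IH]; first by rewrite big_ord0 expr0 mulr1 subrr.
by rewrite big_ord_recr /= IH exprS; field.
Qed.

Lemma geometric_tail_le f N K : (forall n, 0 <= f n) ->
    (forall n, f n <= 2^-1 ^+ n) ->
  \sum_(n < K) f n <= \sum_(n < N) f n + 2 * 2^-1 ^+ N.
Proof.
move=> f0 fn.
(* Enlarging the range to [N + K] allows a split at [N] whether or not [K] exceeds [N]. *)
apply: (@le_trans _ _ (\sum_(n < N + K) f n)).
  rewrite -!(big_mkord xpredT).
  by apply: sum_subset_le => // [||i]; rewrite ?iota_uniq// !mem_index_iota /=;
    move=> iK; rewrite (leq_trans iK)// leq_addl.
rewrite big_split_ord /= lerD2l.
apply: (@le_trans _ _ (\sum_(i < K) 2^-1 ^+ N * 2^-1 ^+ i)).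
  by apply: ler_sum => i _; rewrite -exprD; exact: fn.
by rewrite -mulr_sumr mulrC ler_wpM2r ?geometric_sum_le.
Qed.

End geometric_sums.

Section sequences_in_l2.
Variables (R : realType) (X : choiceType).
Implicit Types (u v : l2 R X) (a : nat -> X).

Lemma mkseq_notin_injective (T : choiceType) (a : nat -> T) :
  (forall n, a n \notin mkseq a n) -> injective a.
Proof.
move=> H m n; wlog mn : m n / (m <= n)%N => [W|amn].
  by have [/W//|/ltnW /W h /esym/h] := leqP m n.
apply/eqP; rewrite eqn_leq mn /= leqNgt; apply/negP => lt_mn.
have := H n; rewrite -amn => /negP; apply; apply/mapP; exists m => //.
by rewrite mem_iota.
Qed.

Lemma restriction_range_le a u (M : R) :
    (forall N, \sum_(n < N) normsq (u (a n)) <= M) ->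
  l2norm (restriction (range a) u) ^+ 2 <= M.
Proof.
move=> H; apply: l2norm_le_sum => s us.
(* [k] picks one index for each point of the range, so a finite set of such points becomes a set of
   distinct indices below a common bound. *)
have /choice[k Hk] : forall x, exists n, x \in range a -> a n = x.
  move=> x; have [|_] := boolP (x \in range a); last by exists 0%N.
  by rewrite inE => -[n _ an]; exists n.
pose t := [seq k x | x <- s & x \in range a].
have ut : uniq t.
  rewrite map_inj_in_uniq ?filter_uniq// => x y.
  by rewrite !mem_filter => /andP[/Hk xa _] /andP[/Hk ya _] kxy; rewrite -xa kxy.
have -> : \sum_(x <- s) normsq (restriction (range a) u x) =
    \sum_(n <- t) normsq (u (a n)).
  rewrite /t big_map big_filter [RHS]big_mkcond; apply: eq_bigr => x _.
  by rewrite restrictionE; case: (boolP (x \in range a)) => [/Hk ->//|_]; rewrite normsq0.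
apply: le_trans (H (\max_(n <- t) n).+1).
rewrite -(big_mkord xpredT (fun n => normsq (u (a n)))); apply: sum_subset_le => //.
- by move=> n; exact: normsq_ge0.
- exact: iota_uniq.
- by move=> n nt; rewrite mem_index_iota /= ltnS; exact: leq_bigmax_seq.
Qed.

Lemma restriction_adjoint (A : set X) :
  is_adjoint (restriction A : l2 R X -> l2 R X) (restriction A).
Proof.
apply: bounded_hermitian => [|x y]; first exact: restriction_bounded.
rewrite !restrictionE /=; have [->|xy] := eqVneq x y.
  by case: ifP => _; rewrite ?conjC1 ?conjC0.
by case: ifP => _; case: ifP => _; rewrite ?conjC0.
Qed.

Lemma restriction_idem (A : set X) :
  restriction A \o restriction A = restriction A :> (l2 R X -> l2 R X).
Proof.
apply/funext => u; apply/val_inj/funext => x.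
rewrite -[LHS]/(restriction A (restriction A u) x) -[RHS]/(restriction A u x).
by rewrite !restrictionE; case: (x \in A).
Qed.

(** Compactness would give the sequence a cluster point [p]. Two distinct terms within 1/2 of [p]
    are at distance less than 1, while orthonormal vectors are at distance the square root of 2. *)
Lemma orthonormal_not_compact (T : l2 R X -> l2 R X) (b : nat -> l2 R X) :
    (forall n, inner (b n) (b n) = 1) ->
    (forall m n, m != n -> inner (b m) (b n) = 0) ->
    (forall n, T (b n) = b n) ->
  ~ compact_operator T.
Proof.
move=> b1 b0 Tb cT.
have nb n : l2norm (b n) = 1.
  apply/eqP; rewrite -(@eqrXn2 _ 2%N) ?l2norm_ge0// expr1n; apply/eqP/complexI.
  by rewrite -inner_normE b1.
have [|p [_ cp]] := cT (b @ \oo) _.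
  exists 0%N => // n _; apply: subset_closure; exists (b n); last exact: Tb.
  by rewrite /= nb.
have ball_p : nbhs p (ball p (2^-1 : R[i])).
  by apply: nbhsx_ballx; rewrite invr_gt0.
have far N : exists2 n, (N <= n)%N & l2norm (p - b n) < 2^-1.
  have [|_ [[n /= Nn <-]]] := cp [set b n | n in [set n | (N <= n)%N]] _ _ ball_p.
    by exists N => // n /= Nn; exists n.
  rewrite -ball_normE /ball_ /= l2_normE => H; exists n => //.
  by rewrite -ltcR (lt_le_trans H)// fmorphV /= rmorph_nat.
have [m _ Hm] := far 0%N; have [n mn Hn] := far m.+1.
have nm : n != m by rewrite gtn_eqF.
have e : l2norm (b m - b n) ^+ 2 = 2.
  apply: complexI; rewrite -inner_normE innerDl !innerDr !innerNl !innerNr.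
  rewrite !b1 (b0 _ _ nm) b0 1?eq_sym// oppr0 opprK addr0 add0r.
  by rewrite [RHS](rmorph_nat (real_complex R) 2).
have : l2norm (b m - b n) < 1.
  have -> : b m - b n = (-1) *: (p - b m) + (p - b n).
    by rewrite scaleN1r opprB addrA subrK.
  rewrite (le_lt_trans (l2normD _ _))// l2normZ normsqN normsq1 sqrtr1 mul1r.
  by rewrite [ltRHS](_ : _ = 2^-1 + 2^-1) ?ltrD//; field.
move=> lt1; have : l2norm (b m - b n) ^+ 2 < 1 by rewrite expr_lt1 ?l2norm_ge0.
by rewrite e ltNge ler1n.
Qed.

End sequences_in_l2.

(** * Ghost projections and large coefficients *)

Lemma seq_upper_bound (R : realDomainType) (T : eqType) (f : T -> R) (s : seq T) :
  exists D, forall x, x \in s -> f x <= D.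
Proof.
elim: s => [|x s [D HD]]; first by exists 0.
exists (Num.max (f x) D) => y; rewrite inE le_max => /orP[/eqP->|/HD ->].
  by rewrite lexx.
by rewrite orbT.
Qed.

Section spatial_pair.
Variables (R : realType) (X Y : metricType R).
Variables (Phi : (l2 R X -> l2 R X) -> (l2 R Y -> l2 R Y)).
Variables (Psi : (l2 R Y -> l2 R Y) -> (l2 R X -> l2 R X)).
Variables (xi : X -> l2 R Y) (eta : Y -> l2 R X).
Hypothesis spPhi : spatial Phi xi.
Hypothesis spPsi : spatial Psi eta.
Hypothesis PsiPhi : forall T, roe X T -> Psi (Phi T) = T.
Hypothesis etaE : forall x y, eta y x = (xi x y)^*.

Let normsq_eta x y : normsq (eta y x) = normsq (xi x y).
Proof. by rewrite etaE normsq_conj. Qed.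

Let entry T y y' : roe X T -> Phi T (delta R y') y = inner (T (eta y')) (eta y).
Proof.
by move=> rT; rewrite (spatial_entry spPsi _ _ (spatial_roe spPhi rT)) PsiPhi.
Qed.

Lemma roe_restriction (A : set X) : roe X (restriction A).
Proof.
by apply: (@roe_ptrans _ _ _ _ 0) => x y; case: ifP => // _ [->]; rewrite mdistxx.
Qed.

(** [spatial] carries no clause on adjoints; symmetry is recovered from the matrix entries, which
    are inner products with the vectors [eta y]. *)
Lemma Phi_restriction_adjoint (A : set X) :
  is_adjoint (Phi (restriction A)) (Phi (restriction A)).
Proof.
have rA := roe_restriction A.
apply: bounded_hermitian; first exact: roe_bounded (spatial_roe spPhi rA).
by move=> y y'; rewrite !(entry _ _ rA) -innerC restriction_adjoint.
Qed.

Lemma Phi_restriction_projection (A : set X) : projection (Phi (restriction A)).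
Proof.
split; last exact: Phi_restriction_adjoint.
have rA := roe_restriction A.
by rewrite -(spatial_comp spPhi rA rA) restriction_idem.
Qed.

Lemma Phi_restriction_fix (A : set X) x : A x -> Phi (restriction A) (xi x) = xi x.
Proof.
move=> Ax; have rA := roe_restriction A; have rm := roe_munit x x.
have e : restriction A \o munit x x = munit x x :> (l2 R X -> l2 R X).
  apply/funext => u; apply/val_inj/funext => z.
  rewrite -[LHS]/(restriction A (munit x x u) z) -[RHS]/(munit x x u z).
  rewrite restrictionE munitE l2ZE /=; case: (z =P x) => [->|_].
    by rewrite mem_set.
  by rewrite mulr0 if_same.
have := congr1 (fun S => S (xi x)) (spatial_comp spPhi rA rm).
by rewrite e /= !(spatial_munit spPhi) (spatial_inner spPhi) scale1r.
Qed.

(** By Cauchy-Schwarz, a squared entry in column [y] is at most the sum of the squared coefficients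
    of [eta y] over the range of [a]. The tail is geometric uniformly in [y], and the first [N]
    terms are small for [y] outside a finite set. *)
Lemma Phi_restriction_ghost (a : nat -> X) :
    (forall n y, normsq (xi (a n) y) <= 2^-1 ^+ n) ->
  ghost (Phi (restriction (range a))).
Proof.
move=> small eps e0; pose d := eps ^+ 2.
have d0 : 0 < d by rewrite exprn_gt0.
have [N HN] : exists N, 2 * (2^-1 : R) ^+ N < d / 2.
  have [N _ HN] : \forall N \near \oo, (2^-1 : R) ^+ N < d / 4.
    have : (2^-1 : R) ^+ n @[n --> \oo] --> (0 : R).
      by apply: cvg_expr; rewrite ger0_norm ?invr_ge0// invf_lt1// ltr1n.
    move=> /cvgr0Pnorm_lt /(_ (d / 4)); rewrite divr_gt0// => /(_ isT).
    apply: filterS => n; rewrite ger0_norm// exprn_ge0// invr_ge0//.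
  exists N; have /= := HN N (leqnn N); rewrite -(ltr_pM2l (_ : 0 < 2))//.
  by move/lt_le_trans; apply; rewrite le_eqVlt; apply/orP; left; apply/eqP; field.
(* With this threshold the [N] head terms add up to at most [d / 2]; the successor avoids dividing
   by zero when [N = 0]. *)
have c0 : 0 < d / 2 / N.+1%:R by rewrite !divr_gt0.
have /choice[s Hs] n := normsq_small (xi (a n)) c0.
pose F := flatten [seq s n | n <- iota 0 N].
exists [set` F]; first exact: finite_seq.
move=> y y' yF _; rewrite inner_delta normc_def ltcR -/(normsq _).
rewrite -[eps]ger0_norm ?ltW// -sqrtr_sqr ltr_sqrt//.
rewrite (entry _ _ (roe_restriction _)) (le_lt_trans (cauchy_schwarz _ _))//.
rewrite (spatial_norm spPsi) expr1n mulr1.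
apply: (@le_lt_trans _ _ (\sum_(n < N) normsq (eta y (a n)) + 2 * 2^-1 ^+ N)).
  apply: restriction_range_le => K.
  apply: (@geometric_tail_le _ (fun n => normsq (eta y (a n)))) => n.
    exact: normsq_ge0.
  by rewrite normsq_eta.
rewrite -/d [ltRHS](_ : d = d / 2 + d / 2); last by field.
rewrite ler_ltD//.
apply: (@le_trans _ _ (\sum_(n < N) d / 2 / N.+1%:R)).
  apply: ler_sum => n _; rewrite normsq_eta ltW// Hs//.
  apply: contra_notN yF => yn; apply/flattenP; exists (s n) => //.
  by apply: map_f; rewrite mem_iota /= add0n ltn_ord.
rewrite sumr_const card_ord -[leLHS]mulr_natr -mulrA ler_piMr//.
  by rewrite divr_ge0// ltW.
by rewrite ler_pdivrMl// mulr1 ler_nat.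
Qed.

Lemma large_coefficient
    (ghostY : forall P : l2 R Y -> l2 R Y, roe Y P -> projection P -> ghost P ->
      compact_operator P) :
  exists2 d : R, 0 < d & forall x, exists y, d <= normsq (xi x y).
Proof.
apply: contrapT => H.
have coef x : exists y, 0 < normsq (xi x y).
  apply: contrapT => nx; have /eqP[] := spatial_neq0 spPhi x.
  apply/val_inj/funext => y /=; apply: normsq_eq0; apply/eqP.
  rewrite eq_le normsq_ge0 andbT leNgt; apply/negP => xy; apply: nx.
  by exists y.
(* Points with uniformly small coefficients exist outside any finite set: a threshold at most some
   positive coefficient of [xi x0] excludes [x0] itself. *)
have small (s : seq X) : forall e : R, 0 < e ->
    exists2 x, x \notin s & forall y, normsq (xi x y) < e.
  elim: s => [|x0 s IH] e e0.
    apply: contrapT => nx; apply: H; exists e => // x.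
    apply: contrapT => nx'; apply: nx; exists x => // y.
    by rewrite ltNge; apply/negP => xy; apply: nx'; exists y.
  have [y0 d0] := coef x0.
  have [|x xs Hx] := IH (Num.min e (normsq (xi x0 y0))).
    by rewrite lt_min e0.
  exists x => [|y]; last by have := Hx y; rewrite lt_min => /andP[].
  rewrite inE negb_or xs andbT; apply/eqP => xx0.
  by have := Hx y0; rewrite lt_min xx0 ltxx andbF.
have [|a Ha] := @sequence_avoiding X (fun s x =>
    x \notin s /\ forall y, normsq (xi x y) < 2^-1 ^+ size s).
  move=> s; have [|x xs Hx] := small s (2^-1 ^+ size s); last by exists x.
  by rewrite exprn_gt0// invr_gt0.
have inj_a : injective a by apply: mkseq_notin_injective => n; case: (Ha n).
have rA := roe_restriction (range a).
apply: (@orthonormal_not_compact R Y (Phi (restriction (range a))) (xi \o a)).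
- by move=> n; exact: spatial_inner spPhi _.
- move=> m n mn; apply: (spatial_orthogonal spPhi).
  by rewrite eq_sym; apply: contra mn => /eqP /inj_a ->.
- by move=> n; apply: Phi_restriction_fix; exists n.
apply: ghostY; [exact: spatial_roe spPhi _ rA|exact: Phi_restriction_projection|].
apply: Phi_restriction_ghost => n y; have [_ /(_ y)] := Ha n.
by rewrite size_mkseq => /ltW.
Qed.

(* If x lies in a finite set, then so do x', y and y', and d(y, y') is bounded. *)
Lemma large_coefficients_far (d r : R) : 0 < d ->
    uniformly_locally_finite (bounded_coarse X) ->
    (forall D : R, exists x x' y y', [/\ mdist x x' <= r, d <= normsq (xi x y),
      d <= normsq (xi x' y') & D < mdist y y']) ->
  forall (s s' : seq X) (t : seq Y) (D : R), exists x x' y y',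
    [/\ mdist x x' <= r, d <= normsq (xi x y), d <= normsq (xi x' y') &
     [/\ D < mdist y y', x \notin s, x' \notin s' & y \notin t]].
Proof.
move=> d0 ulf far s s' t D.
have /choice[L HL] x := normsq_small (xi x) d0.
have /choice[L' HL'] y := normsq_small (eta y) d0.
have /choice[B HB] x := finite_ball ulf r x.
have inL x y : d <= normsq (xi x y) -> y \in L x.
  by apply: contraTT => /HL; rewrite ltNge.
have inL' x y : d <= normsq (xi x y) -> x \in L' y.
  by rewrite -normsq_eta; apply: contraTT => /HL'; rewrite ltNge.
(* [G] contains each [x] of a quadruple with [x] in [s], [x'] in [s'] or [y] in [t], and [H]
   contains the possible [y] and [y'] for such [x]. A distance above all those within [H] thus
   forces [x] out of [G]. *)
pose G := s ++ flatten (map B s') ++ flatten (map L' t).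
pose H := flatten [seq L x ++ flatten (map L (B x)) | x <- G].
have [D' HD'] := seq_upper_bound (fun q => mdist q.1 q.2 : R)
  [seq (y, y') | y <- H, y' <- H].
have [x [x' [y [y' [xx' xy x'y' yy']]]]] := far (Num.max D D').
move: yy'; rewrite gt_max => /andP[Dy D'y].
have xG : x \notin G.
  apply/negP => xG; move: D'y; rewrite ltNge => /negP; apply.
  have inH z : z \in L x ++ flatten (map L (B x)) -> z \in H.
    by move=> zx; apply/flattenP; exists (L x ++ flatten (map L (B x))) => //; exact: map_f.
  apply: (HD' (y, y')); apply: allpairs_f; apply: inH; rewrite mem_cat.
    by rewrite inL.
  apply/orP; right; apply/flattenP; exists (L x'); last exact: inL.
  by apply: map_f; exact: HB.
exists x, x', y, y'; split=> //; split=> //.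
- by apply: contra xG; rewrite mem_cat => ->.
- apply: contra xG => x's; rewrite !mem_cat; apply/orP; right; apply/orP; left.
  by apply/flattenP; exists (B x'); [exact: map_f|apply: HB; rewrite metric_sym].
- apply: contra xG => yt; rewrite !mem_cat; apply/orP; right; apply/orP; right.
  by apply/flattenP; exists (L' y); [exact: map_f|exact: inL'].
Qed.

End spatial_pair.

(** * The coarse estimate *)

Section sequence_translation.
Variables (R : realType) (X : choiceType) (a b : nat -> X).
Hypotheses (inj_a : injective a) (inj_b : injective b).

Lemma sequence_translation_ex : exists2 phi : X -> option X,
  partial_injection phi &
  (forall n, phi (a n) = Some (b n)) /\
  (forall x, phi x = None \/ exists n, x = a n /\ phi x = Some (b n)).
Proof.
have /choice[phi Hphi] : forall x, exists o : option X,
    (forall n, x = a n -> o = Some (b n)) /\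
    (o = None \/ exists n, x = a n /\ o = Some (b n)).
  move=> x; have [[n ->]|nx] := pselect (exists n, x = a n).
    by exists (Some (b n)); split=> [m /inj_a ->//|]; right; exists n.
  by exists None; split=> [n xa|]; [case: nx; exists n|left].
exists phi; last by split=> [n|x]; [exact: (Hphi (a n)).1|exact: (Hphi x).2].
move=> x y z phix phiy.
have [|[n [xn]]] := (Hphi x).2; rewrite phix// => -[zn].
have [|[m [ym]]] := (Hphi y).2; rewrite phiy// => -[zm].
by rewrite xn ym (inj_b (etrans (esym zn) zm)).
Qed.

End sequence_translation.

Section coarse_estimate.
Variables (R : realType) (X Y : metricType R).
Variables (Phi : (l2 R X -> l2 R X) -> (l2 R Y -> l2 R Y)).
Variables (Psi : (l2 R Y -> l2 R Y) -> (l2 R X -> l2 R X)).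
Variables (xi : X -> l2 R Y) (eta : Y -> l2 R X).
Hypothesis spPhi : spatial Phi xi.
Hypothesis spPsi : spatial Psi eta.
Hypothesis PsiPhi : forall T, roe X T -> Psi (Phi T) = T.
Hypothesis etaE : forall x y, eta y x = (xi x y)^*.

(** The quadruples are chosen so sparsely that a single diagonal term dominates each tested entry of
    the image of one partial translation. Those entries stay large arbitrarily far from the
    diagonal, against [uniform_roe_entry]. *)
Lemma large_coefficients_bounded (d r : R) : 0 < d ->
    uniformly_locally_finite (bounded_coarse X) ->
  exists D : R, forall x x' y y', mdist x x' <= r -> d <= normsq (xi x y) ->
    d <= normsq (xi x' y') -> mdist y y' <= D.
Proof.
move=> d0 ulf; apply: contrapT => H.
have far D : exists x x' y y', [/\ mdist x x' <= r, d <= normsq (xi x y),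
    d <= normsq (xi x' y') & D < mdist y y'].
  apply: contrapT => nD; apply: H; exists D => x x' y y' xx' xy x'y'.
  rewrite leNgt; apply/negP => yy'; apply: nD.
  by exists x, x', y, y'.
(* Both the entry bound [k] and the error bound [2 * k] enter doubled in the final estimate, which
   becomes [8 * k < 2 * k + 4 * k]. *)
pose k := d ^+ 2 / 8.
have k0 : 0 < k by rewrite divr_gt0// exprn_gt0.
have [|q Hq] := @sequence_avoiding (X * X * (Y * Y))%type (fun s p =>
    [/\ mdist p.1.1 p.1.2 <= r, d <= normsq (xi p.1.1 p.2.1),
      d <= normsq (xi p.1.2 p.2.2), (size s)%:R < mdist p.2.1 p.2.2 &
    [/\ p.1.1 \notin [seq p'.1.1 | p' <- s], p.1.2 \notin [seq p'.1.2 | p' <- s],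
      forall p', p' \in s -> normsq (xi p'.1.1 p.2.1) < k * 2^-1 ^+ size s &
      forall p', p' \in s -> normsq (xi p.1.1 p'.2.1) < k * 2^-1 ^+ size s]]).
  move=> s; have e0 : 0 < k * 2^-1 ^+ size s.
    by rewrite mulr_gt0// exprn_gt0// invr_gt0.
  have /choice[L HL] x := normsq_small (xi x) e0.
  have /choice[L' HL'] y := normsq_small (eta y) e0.
  (* The lists exclude repetitions of [x] and [x'], the [x] at which an earlier [eta] is large, and
     the [y] at which an earlier [xi] is large. *)
  have [x [x' [y [y' [xx' xy x'y' [yy' xs x's ys]]]]]] :=
    large_coefficients_far etaE d0 ulf far
    ([seq p.1.1 | p <- s] ++ flatten [seq L' p.2.1 | p <- s])
    [seq p.1.2 | p <- s] (flatten [seq L p.1.1 | p <- s]) (size s)%:R.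
  move: xs; rewrite mem_cat negb_or => /andP[xs xL].
  exists (x, x', (y, y')); split=> //; split=> //= p ps.
    apply: HL; apply: contra ys => yL; apply/flattenP; exists (L p.1.1) => //.
    by apply/mapP; exists p.
  have <- : normsq (eta p.2.1 x) = normsq (xi x p.2.1) by rewrite etaE normsq_conj.
  apply: HL'; apply: contra xL => yL; apply/flattenP; exists (L' p.2.1) => //.
  by apply/mapP; exists p.
pose a n := (q n).1.1; pose b n := (q n).1.2.
pose y n := (q n).2.1; pose y' n := (q n).2.2.
have inj_a : injective a.
  apply: mkseq_notin_injective => n; have [_ _ _ _ [h _ _ _]] := Hq n.
  by move: h; rewrite /mkseq -map_comp.
have inj_b : injective b.
  apply: mkseq_notin_injective => n; have [_ _ _ _ [_ h _ _]] := Hq n.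
  by move: h; rewrite /mkseq -map_comp.
have small m n : m != n -> normsq (xi (a m) (y n)) <= k * 2^-1 ^+ m.
  rewrite neq_ltn => /orP[mn|nm].
    have [_ _ _ _ [_ _ h _]] := Hq n.
    have := h (q m); rewrite size_mkseq map_f ?mem_iota// => /(_ isT)/ltW h'.
    rewrite (le_trans h')// ler_wpM2l ?(ltW k0)// ler_wiXn2l ?invr_ge0//.
      by rewrite invf_le1// ler1n.
    exact: ltnW.
  have [_ _ _ _ [_ _ _ h]] := Hq m.
  by have := h (q n); rewrite size_mkseq map_f ?mem_iota// => /(_ isT)/ltW.
have [phi inj_phi [phia phiN]] := sequence_translation_ex inj_a inj_b.
pose T := ptrans (R := R) inj_phi.
have rT : roe X T.
  apply: (@roe_ptrans _ _ _ _ r) => x x'.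
  have [->//|[n [-> ->]] [<-]] := phiN x'; rewrite metric_sym.
  by have [h _ _ _ _] := Hq n.
have [A /bounded_coarseP[D HD] SA] := uniform_roe_entry (spatial_roe spPhi rT) k0.
have [n Dn] : exists n : nat, D < n%:R.
  exists (Num.bound `|D|); rewrite (le_lt_trans (ler_norm D))//.
  by rewrite archi_boundP.
have [_ xy xy' yy' _] := Hq n; rewrite size_mkseq in yy'.
have Sn : normsq (Phi T (delta R (y' n)) (y n)) < k.
  apply: SA => /HD; rewrite metric_sym leNgt => /negP; apply.
  exact: lt_trans Dn yy'.
rewrite (spatial_entry spPsi _ _ (spatial_roe spPhi rT)) PsiPhi// in Sn.
set v := T (eta (y' n)) in Sn; set w := eta (y n) in Sn.
have nv : l2norm v ^+ 2 <= 1.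
  rewrite -(expr1n R 2) -(spatial_norm spPsi (y' n)) -lee_fin -!l2sq_fin.
  exact: l2sq_pullback.
have van : v (a n) = eta (y' n) (b n) by rewrite /v /T ptransE phia.
have Pv : restriction (range a) v = v.
  apply/val_inj/funext => x; rewrite -[LHS]/(restriction (range a) v x).
  rewrite -[RHS]/(v x) restrictionE; case: (boolP (x \in range a)) => // xa.
  rewrite /v /T ptransE; have [->//|[m [xm _]]] := phiN x.
  by case/negP: xa; rewrite inE; exists m.
(* Since [v] is supported on the range of [a], the inner product splits into the term at [a n] and a
   contribution of the other [a m], which [small] controls by a geometric series. *)
pose w0 := w - w (a n) *: delta R (a n).
have split_entry : inner v w = v (a n) * (w (a n))^* + inner v (restriction (range a) w0).
  rewrite -restriction_adjoint Pv -[in LHS](subrK (w (a n) *: delta R (a n)) w).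
  by rewrite innerDr innerZr inner_delta addrC mulrC.
have err : l2norm (restriction (range a) w0) ^+ 2 <= 2 * k.
  apply: restriction_range_le => N.
  apply: (@le_trans _ _ (\sum_(m < N) k * 2^-1 ^+ m)).
    apply: ler_sum => m _.
    have -> : w0 (a m) = w (a m) - w (a n) * (a m == a n)%:R by [].
    have [->|mn] := eqVneq (m : nat) n.
      by rewrite eqxx mulr1 subrr normsq0 mulr_ge0 ?exprn_ge0 ?invr_ge0// ltW.
    rewrite (inj_eq inj_a) (negbTE mn) mulr0 subr0 /w etaE normsq_conj.
    exact: small.
  by rewrite -mulr_sumr mulrC ler_wpM2r ?geometric_sum_le// ltW.
have main : d ^+ 2 <= normsq (v (a n) * (w (a n))^*).
  rewrite normsqM normsq_conj van /w !etaE !normsq_conj expr2.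
  by rewrite ler_pM// ltW.
have err_entry : normsq (inner v (restriction (range a) w0)) <= 2 * k.
  rewrite (le_trans (cauchy_schwarz _ _))// -[leRHS]mul1r.
  by rewrite ler_pM ?sqr_ge0.
have : d ^+ 2 <= 2 * normsq (inner v w) + 2 * (2 * k).
  rewrite (le_trans main)//.
  have -> : v (a n) * (w (a n))^* = inner v w + - inner v (restriction (range a) w0).
    by rewrite split_entry addrK.
  rewrite (le_trans (normsqD _ _ ltr01))// normsqN invr1 lerD// ler_wpM2l//.
have -> : d ^+ 2 = 8 * k by rewrite /k; field.
by move: Sn k0; lra.
Qed.

End coarse_estimate.

(** * Assembly of the coarse equivalence *)

Theorem corollary1p3 (R : realType) (X Y : metricType R)
    (ulfX : uniformly_locally_finite (bounded_coarse X))
    (ulfY : uniformly_locally_finite (bounded_coarse Y))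
    (ghostX : forall P : l2 R X -> l2 R X, uniform_roe R (bounded_coarse X) P ->
       projection P -> ghost P -> compact_operator P)
    (ghostY : forall P : l2 R Y -> l2 R Y, uniform_roe R (bounded_coarse Y) P ->
       projection P -> ghost P -> compact_operator P)
    (isoXY : star_isomorphic (uniform_roe R (bounded_coarse X))
                             (uniform_roe R (bounded_coarse Y))) :
  coarsely_equivalent (bounded_coarse X) (bounded_coarse Y).
Proof.
case: isoXY => Phi [Phi_bij _ Phi_scale Phi_comp Phi_adj].
(* The vectors require a base point. If [X] is empty, all operators on its [l2] space coincide, so a
   point of [Y] would give a vanishing matrix unit; hence [Y] is empty too. *)
have [[x0]|nX] := pselect (inhabited X); last first.
  have nY (y : Y) : False.
    have [T rT TE] := Phi_surj Phi_bij (roe_munit y y).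
    apply: (@munit_neq0 R Y y y); rewrite -[in RHS]TE -Phi_scale// -[LHS]TE.
    congr Phi; apply/funext => u; apply/val_inj/funext => x.
    by case: nX; exists.
  exists (fun x => False_rect Y (nX (inhabits x))); split.
    move=> A _; exists set0; last by move=> x; case: nX; exists.
    by apply/bounded_coarseP; exists 0 => ? ?.
  exists (fun y => False_rect X (nY y)); split.
  - move=> A _; exists set0; last by move=> y; case: (nY y).
    by apply/bounded_coarseP; exists 0 => ? ?.
  - by apply/bounded_coarseP; exists 0 => x; case: nX; exists.
  - by apply/bounded_coarseP; exists 0 => y; case: (nY y).
have [Psi [xi [eta [spPhi spPsi PsiPhi PhiPsi etaE]]]] :=
  spatial_inverse Phi_bij Phi_scale Phi_comp Phi_adj x0.
have xiE y x : xi x y = (eta y x)^* by rewrite etaE conjCK.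
have [c c0 Hc] := large_coefficient spPhi spPsi PsiPhi etaE ghostY.
have [c' c'0 Hc'] := large_coefficient spPsi spPhi PhiPsi xiE ghostX.
pose d := Num.min c c'.
have d0 : 0 < d by rewrite lt_min c0.
have normsq_eta x y : normsq (eta y x) = normsq (xi x y).
  by rewrite etaE normsq_conj.
have /choice[f Hf] : forall x, exists y, d <= normsq (xi x y).
  by move=> x; have [y xy] := Hc x; exists y; rewrite (le_trans _ xy)// ge_min lexx.
have /choice[g Hg] : forall y, exists x, d <= normsq (eta y x).
  by move=> y; have [x xy] := Hc' y; exists x; rewrite (le_trans _ xy)// ge_min lexx orbT.
have bndX r := @large_coefficients_bounded R X Y _ _ _ _ spPhi spPsi PsiPhi etaE d r d0 ulfX.
have bndY r := @large_coefficients_bounded R Y X _ _ _ _ spPsi spPhi PhiPsi xiE d r d0 ulfY.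
exists f; split.
  move=> A /bounded_coarseP[r Ar]; have [D HD] := bndX r.
  exists [set yy | mdist yy.1 yy.2 <= D]; first by apply/bounded_coarseP; exists D.
  by move=> x x' /Ar xx' /=; exact: HD xx' (Hf x) (Hf x').
exists g; split.
- move=> A /bounded_coarseP[r Ar]; have [D HD] := bndY r.
  exists [set xx | mdist xx.1 xx.2 <= D]; first by apply/bounded_coarseP; exists D.
  by move=> y y' /Ar yy' /=; exact: HD yy' (Hg y) (Hg y').
(* Both [g (f x)] and [x] carry a large coefficient of [eta (f x)], so the estimate with radius 0
   bounds their distance. *)
- apply/bounded_coarseP; have [D HD] := bndY 0; exists D => _ _ [x _ [<- <-]].
  by apply: (HD (f x) (f x)); rewrite ?mdistxx// normsq_eta.
- apply/bounded_coarseP; have [D HD] := bndX 0; exists D => _ _ [y _ [<- <-]].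
  by apply: (HD (g y) (g y)); rewrite ?mdistxx// -normsq_eta.
Qed.
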